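(* Consider a nonabelian Chaplygin nonholonomic system as described in the context with two degrees of freedom ($m=2$) and with $G_{\alpha\beta}$ invertible. The necessary and sufficient condition for it to be Chaplygin Hamiltonizable is that $$\frac{\partial K^1_{12}}{\partial r^1}=-\frac{\partial K^2_{12}}{\partial r^2},$$ or equivalently that the reduced system possess a nonzero invariant measure density $N(r)\in C^1$. The multiplier is then given by $f(r)=e^{\int K^1_{12}\,dr^2}=N$.
   Context: $Q$ is an $n$-dimensional manifold with mechanical Lagrangian $L$ and linear nonholonomic constraint distribution $\mathcal D$; a matrix Lie group $G$ of dimension $k$ acts freely and properly, leaving $L$ and $\mathcal D$ invariant, with $\mathcal D_q\oplus T_q\mathrm{Orb}(q)=T_qQ$, $Q\ne G$. Shape space $M=Q/G$ with coordinates $r^\alpha$, $\alpha=1,\dots,m$, here $m=2$. With $\{b_a\}$ a basis of $\mathfrak g$, structure constants $C^a_{bc}$, $\xi=g^{-1}\dot g$: reduced Lagrangian $l=\tfrac12g_{\alpha\beta}\dot r^\alpha\dot r^\beta+g_{a\alpha}\dot r^\alpha\xi^a+\tfrac12g_{ab}\xi^a\xi^b-V(r)$; constraints $\xi^a=-\mathcal A^a_\alpha(r)\dot r^\alpha$; $l_c(r,\dot r)=l(r,\dot r,-\mathcal A\dot r)$; $G_{\alpha\beta}=\partial^2l_c/\partial\dot r^\alpha\partial\dot r^\beta$ with inverse $G^{\alpha\beta}$; $\tilde p_\alpha=\partial l_c/\partial\dot r^\alpha$; $h=\tilde p_\alpha\dot r^\alpha-l_c$; $\mathcal B^a_{\alpha\beta}=\partial\mathcal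 A^a_\alpha/\partial r^\beta-\partial\mathcal A^a_\beta/\partial r^\alpha+C^a_{bc}\mathcal A^b_\alpha\mathcal A^c_\beta$; $(\mu_a)_c=\partial l/\partial\xi^a$ with constraints substituted; $M_{a\alpha}=g_{a\alpha}-g_{ab}\mathcal A^b_\alpha$; $K^\gamma_{\beta\alpha}=M_{b\epsilon}G^{\epsilon\gamma}\mathcal B^b_{\beta\alpha}$. The reduced equations are $\dot r^\alpha=\partial h/\partial\tilde p_\alpha$, $\dot{\tilde p}_\alpha=-\partial h/\partial r^\alpha-(\mu_a)_c\mathcal B^a_{\alpha\beta}\partial h/\partial\tilde p_\beta$, with almost-Poisson bracket $\{g,k\}^{Chap}_{AP}=\{g,k\}_{can}+\Lambda_{\alpha\beta}\frac{\partial g}{\partial\tilde p_\alpha}\frac{\partial k}{\partial\tilde p_\beta}$, $\Lambda_{\alpha\beta}=(\mu_a)_c\mathcal B^a_{\beta\alpha}$. Chaplygin Hamiltonizable means: there is a nowhere-zero $f(r)\in C^1$ such that, with $\dot r=f\omega$, $\tilde{\mathcal P}_\alpha=f\tilde p_\alpha$, the bracket $\{g,k\}^{Chap}_{AP}$ expressed in the variables $(r,\tilde{\mathcal P})$ equals $f$ times the canonical bracket in $(r,\tilde{\mathcal P})$ (equivalently, the reduced dynamics is Hamiltonian after the time reparameterization $d\tau=f\,dt$); $f$ is the multiplier. An invariant measure density is a function $N(r)$ such that the measure $N\,dr^1dr^2d\tilde p_1d\tilde p_2$ is preserved by the flow of the reduced equations. *)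

(* Defs.v *)
From Stdlib Require Import Reals List.
From Coquelicot Require Import Coquelicot.
Import ListNotations.
Open Scope R_scope.

Definition sumk (n : nat) (F : nat -> R) : R :=
  fold_right Rplus 0 (map F (seq 0 n)).

Definition cmp2 (alpha : nat) (v : R * R) : R :=
  match alpha with O => fst v | _ => snd v end.

(* partial derivatives of a function on R^2 (coordinates r^1, r^2 are
   indexed 0 and 1) *)
Definition pd1 (F : R * R -> R) (r : R * R) : R :=
  Derive (fun t => F (t, snd r)) (fst r).
Definition pd2 (F : R * R -> R) (r : R * R) : R :=
  Derive (fun t => F (fst r, t)) (snd r).
Definition dd (alpha : nat) (F : R * R -> R) : R * R -> R :=
  match alpha with O => pd1 F | _ => pd2 F end.

Definition exd (alpha : nat) (F : R * R -> R) (r : R * R) : Prop :=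
  match alpha with
  | O => ex_derive (fun t => F (t, snd r)) (fst r)
  | _ => ex_derive (fun t => F (fst r, t)) (snd r)
  end.

Fixpoint Ck (U : R * R -> Prop) (n : nat) (F : R * R -> R) : Prop :=
  match n with
  | O => forall r, U r -> continuous F r
  | S n' => (forall r, U r -> exd 0 F r /\ exd 1 F r)
            /\ Ck U n' F /\ Ck U n' (pd1 F) /\ Ck U n' (pd2 F)
  end.

Definition smooth_on (U : R * R -> Prop) (F : R * R -> R) : Prop :=
  forall n, Ck U n F.

Definition C1_on (U : R * R -> Prop) (F : R * R -> R) : Prop := Ck U 1 F.

(* functions on phase space (r, p~) in (R^2) x (R^2) *)
Definition drP (alpha : nat) (g : R * R -> R * R -> R) (r p : R * R) : R :=
  dd alpha (fun r' => g r' p) r.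
Definition dpP (alpha : nat) (g : R * R -> R * R -> R) (r p : R * R) : R :=
  dd alpha (fun p' => g r p') p.

Definition uncurry2 (g : R * R -> R * R -> R) : (R * R) * (R * R) -> R :=
  fun z => g (fst z) (snd z).

Definition phase_C1 (U : R * R -> Prop) (g : R * R -> R * R -> R) : Prop :=
  forall r p, U r ->
    continuous (uncurry2 g) (r, p) /\
    forall alpha, (alpha < 2)%nat ->
      exd alpha (fun r' => g r' p) r /\ exd alpha (fun p' => g r p') p /\
      continuous (uncurry2 (drP alpha g)) (r, p) /\
      continuous (uncurry2 (dpP alpha g)) (r, p).

Definition convex_set (U : R * R -> Prop) : Prop :=
  forall x y t, U x -> U y -> 0 <= t <= 1 ->
    U (t * fst x + (1 - t) * fst y, t * snd x + (1 - t) * snd y).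

(* Reduced data of the Chaplygin system, in shape coordinates r=(r^1,r^2) *)
(*   k            : dim G;   group indices a,b,c in {0..k-1}             *)
(*   C a b c      : structure constants C^a_{bc}                        *)
(*   gs al be r   : g_{alpha beta}(r)                                   *)
(*   gm a al r    : g_{a alpha}(r)                                      *)
(*   gg a b r     : g_{ab}(r)                                           *)
(*   V r          : potential                                           *)
(*   A a al r     : connection coefficients A^a_alpha(r)                *)

Section Chaplygin.
Variable k : nat.
Variable C : nat -> nat -> nat -> R.
Variables gs gm gg : nat -> nat -> R * R -> R.
Variable V : R * R -> R.
Variable A : nat -> nat -> R * R -> R.

(* reduced Lagrangian l(r, rdot, xi) *)
Definition lred (r v : R * R) (xi : nat -> R) : R :=
  / 2 * sumk 2 (fun al => sumk 2 (fun be => gs al be r * cmp2 al v * cmp2 be v))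
  + sumk k (fun a => sumk 2 (fun al => gm a al r * cmp2 al v * xi a))
  + / 2 * sumk k (fun a => sumk k (fun b => gg a b r * xi a * xi b))
  - V r.

Definition xic (r v : R * R) (a : nat) : R :=
  - sumk 2 (fun al => A a al r * cmp2 al v).

Definition lc (r v : R * R) : R := lred r v (xic r v).

(* G_{alpha beta} = d^2 l_c / d rdot^alpha d rdot^beta ; l_c is quadratic
   in rdot, so the Hessian is independent of rdot; we evaluate at rdot=0 *)
Definition Gmat (al be : nat) (r : R * R) : R :=
  dd al (fun v => dd be (fun v' => lc r v') v) (0, 0).

Definition detG (r : R * R) : R :=
  Gmat 0 0 r * Gmat 1 1 r - Gmat 0 1 r * Gmat 1 0 r.

Definition Ginv (al be : nat) (r : R * R) : R :=
  match al, be with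
  | O, O => Gmat 1 1 r / detG r
  | O, _ => - Gmat 0 1 r / detG r
  | _, O => - Gmat 1 0 r / detG r
  | _, _ => Gmat 0 0 r / detG r
  end.

(* velocity corresponding to momentum p~ (inverse of p~ = dl_c/drdot = G rdot) *)
Definition vel (r p : R * R) : R * R :=
  (sumk 2 (fun be => Ginv 0 be r * cmp2 be p),
   sumk 2 (fun be => Ginv 1 be r * cmp2 be p)).

Definition ham (r p : R * R) : R :=
  sumk 2 (fun al => cmp2 al p * cmp2 al (vel r p)) - lc r (vel r p).

(* (mu_a)_c = dl/dxi^a with constraints substituted, function of (r, rdot) *)
Definition muc (a : nat) (r v : R * R) : R :=
  Derive (fun t => lred r v (fun b => if Nat.eqb b a then t else xic r v b))
         (xic r v a).

Definition Bc (a al be : nat) (r : R * R) : R :=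
  dd be (A a al) r - dd al (A a be) r
  + sumk k (fun b => sumk k (fun c => C a b c * A b al r * A c be r)).

Definition Mm (a al : nat) (r : R * R) : R :=
  gm a al r - sumk k (fun b => gg a b r * A b al r).

Definition Kc (ga be al : nat) (r : R * R) : R :=
  sumk k (fun b => sumk 2 (fun eps => Mm b eps r * Ginv eps ga r * Bc b be al r)).

Definition Xr (al : nat) (r p : R * R) : R := dpP al ham r p.
Definition rdot (r p : R * R) : R * R := (Xr 0 r p, Xr 1 r p).
Definition Xp (al : nat) (r p : R * R) : R :=
  - drP al ham r p
  - sumk k (fun a => sumk 2 (fun be =>
        muc a r (rdot r p) * Bc a al be r * dpP be ham r p)).

Definition Lam (al be : nat) (r p : R * R) : R :=
  sumk k (fun a => muc a r (rdot r p) * Bc a be al r).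

Definition can_br (g h : R * R -> R * R -> R) (r p : R * R) : R :=
  sumk 2 (fun al => drP al g r p * dpP al h r p - dpP al g r p * drP al h r p).

Definition AP_br (g h : R * R -> R * R -> R) (r p : R * R) : R :=
  can_br g h r p
  + sumk 2 (fun al => sumk 2 (fun be =>
        Lam al be r p * dpP al g r p * dpP be h r p)).

(* f is a multiplier (on the coordinate domain U): with P~ = f p~ the
   bracket, expressed in (r, P~), equals f times the canonical bracket
   in (r, P~). *)
Definition is_multiplier (U : R * R -> Prop) (f : R * R -> R) : Prop :=
  C1_on U f /\ (forall r, U r -> f r <> 0) /\
  forall g h : R * R -> R * R -> R,
    phase_C1 U g -> phase_C1 U h ->
    forall r p, U r ->
      AP_br (fun r' p' => g r' (f r' * fst p', f r' * snd p'))
            (fun r' p' => h r' (f r' * fst p', f r' * snd p')) r p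
      = f r * can_br g h r (f r * fst p, f r * snd p).

Definition chaplygin_hamiltonizable (U : R * R -> Prop) : Prop :=
  exists f, is_multiplier U f.

(* N(r) is an invariant measure density: C^1, nowhere vanishing, and the
   measure N dr^1 dr^2 dp~_1 dp~_2 is preserved by the reduced flow,
   i.e. (Liouville) div(N X) = 0 *)
Definition invariant_density (U : R * R -> Prop) (N : R * R -> R) : Prop :=
  C1_on U N /\ (forall r, U r -> N r <> 0) /\
  forall r p, U r ->
    sumk 2 (fun al =>
      drP al (fun r' p' => N r' * Xr al r' p') r p
      + dpP al (fun r' p' => N r' * Xp al r' p') r p) = 0.

End Chaplygin.

(* Main.v *)
Require Import Defs.
From Stdlib Require Import Reals List Lra Lia.
From Coquelicot Require Import Coquelicot.
Open Scope R_scope.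

(* Along the rescaling p = f P, the defect of the Chaplygin bracket from f times the canonical
   bracket is a multiple of [(d2 f - K^1_12 f) p1 - (d1 f + K^2_12 f) p2]: the gyroscopic
   coefficient is Lambda_12 = -(p1 K^1_12 + p2 K^2_12).  Hence multipliers are exactly the
   nowhere-vanishing solutions of [d2 f = K^1_12 f, d1 f = - K^2_12 f].  The Liouville divergence
   of N times the reduced vector field is the same linear form in the velocities with N in place
   of f, so invariant densities are the same functions.  The system is solvable iff its
   compatibility condition d1 K^1_12 = - d2 K^2_12 holds: necessity is the symmetry of the mixed
   partials of f, sufficiency the Poincare lemma on the convex domain, f being the exponential of
   the radial potential of the closed form - K^2_12 dr^1 + K^1_12 dr^2. *)

(* Coquelicot states its equalities in [NormedModule.sort R_NormedModule]; [ring] needs [R]. *)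
Ltac ring_R := match goal with |- ?x = ?y => change (x = y :> R) end; ring.

(** * Finite sums *)

Lemma fold_right_Rplus_init (l : list R) (x : R) :
  fold_right Rplus x l = fold_right Rplus 0 l + x.
Proof. induction l; simpl; [ring | rewrite IHl; ring]. Qed.

Lemma sumk_S n F : sumk (S n) F = sumk n F + F n.
Proof.
  unfold sumk. rewrite seq_S, map_app, fold_right_app. simpl.
  rewrite fold_right_Rplus_init. ring.
Qed.

Lemma sumk_2 F : sumk 2 F = F 0%nat + F 1%nat.
Proof. unfold sumk; simpl; ring. Qed.

Lemma sumk_ext n F G : (forall i, (i < n)%nat -> F i = G i) -> sumk n F = sumk n G.
Proof. induction n; intros H; [reflexivity | rewrite !sumk_S, IHn, H; auto]. Qed.

Lemma sumk_plus n F G : sumk n (fun i => F i + G i) = sumk n F + sumk n G.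
Proof. induction n; [unfold sumk; simpl; ring | rewrite !sumk_S, IHn; ring]. Qed.

Lemma sumk_scal n c F : sumk n (fun i => c * F i) = c * sumk n F.
Proof. induction n; [unfold sumk; simpl; ring | rewrite !sumk_S, IHn; ring]. Qed.

Lemma sumk_opp n F : sumk n (fun i => - F i) = - sumk n F.
Proof. induction n; [unfold sumk; simpl; ring | rewrite !sumk_S, IHn; ring]. Qed.

Lemma sumk_lin2 n x y F G :
  sumk n (fun a => x * F a + y * G a) = x * sumk n F + y * sumk n G.
Proof. rewrite sumk_plus, !sumk_scal. reflexivity. Qed.

Lemma sumk_zero n : sumk n (fun _ => 0) = 0.
Proof. induction n; [reflexivity | rewrite sumk_S, IHn; ring]. Qed.

Lemma sumk_swap n m F :
  sumk n (fun i => sumk m (fun j => F i j)) = sumk m (fun j => sumk n (fun i => F i j)).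
Proof.
  induction n.
  - symmetry; apply sumk_zero.
  - rewrite sumk_S, IHn, <- sumk_plus. apply sumk_ext; intros. rewrite sumk_S. ring.
Qed.

Lemma sumk_kronecker n a F : (a < n)%nat ->
  sumk n (fun i => (if Nat.eqb i a then 1 else 0) * F i) = F a.
Proof.
  induction n; intros H; [lia |].
  rewrite sumk_S. destruct (Nat.eq_dec a n) as [-> | Hne].
  - rewrite Nat.eqb_refl, (sumk_ext n _ (fun _ => 0)), sumk_zero; [ring |].
    intros i Hi. destruct (Nat.eqb_spec i n); [lia | ring].
  - rewrite IHn by lia. destruct (Nat.eqb_spec n a); [lia | ring].
Qed.

Lemma sumk_antisym n (C : nat -> nat -> R) (X : nat -> R) :
  (forall b c, C b c = - C c b) ->
  sumk n (fun b => sumk n (fun c => C b c * X b * X c)) = 0.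
Proof.
  intros HC.
  enough (E : sumk n (fun b => sumk n (fun c => C b c * X b * X c))
            = - sumk n (fun b => sumk n (fun c => C b c * X b * X c))) by lra.
  rewrite sumk_swap at 1. rewrite <- sumk_opp. apply sumk_ext; intros.
  rewrite <- sumk_opp. apply sumk_ext; intros. rewrite HC. ring.
Qed.

Lemma is_derive_sumk n (F : nat -> R -> R) (dF : nat -> R) x :
  (forall i, (i < n)%nat -> is_derive (F i) x (dF i)) ->
  is_derive (fun t => sumk n (fun i => F i t)) x (sumk n dF).
Proof.
  induction n; intros H.
  - apply (is_derive_const 0).
  - rewrite sumk_S.
    apply (is_derive_ext (fun t => sumk n (fun i => F i t) + F n t));
      [intros; rewrite sumk_S; reflexivity |].
    apply (is_derive_plus (fun t => sumk n (fun i => F i t)) (F n)); auto.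
Qed.

(** * Calculus in the plane *)

Lemma continuous_pair {T A B : UniformSpace} (f : T -> A) (g : T -> B) x :
  continuous f x -> continuous g x -> continuous (fun y => (f y, g y)) x.
Proof.
  intros Hf Hg. apply (continuous_comp_2 f g (fun a b => (a, b))); auto.
  apply (continuous_ext (fun z => z)); [intros [a b]; reflexivity | apply continuous_id].
Qed.

Lemma continuous_fst_pt {A B : UniformSpace} (w : A * B) : continuous (fun z : A * B => fst z) w.
Proof. destruct w; apply continuous_fst. Qed.
Lemma continuous_snd_pt {A B : UniformSpace} (w : A * B) : continuous (fun z : A * B => snd z) w.
Proof. destruct w; apply continuous_snd. Qed.

Lemma continuous_Rplus {T : UniformSpace} (f g : T -> R) x :
  continuous f x -> continuous g x -> continuous (fun y => f y + g y) x.
Proof. exact (continuous_plus f g x). Qed.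
Lemma continuous_Rmult {T : UniformSpace} (f g : T -> R) x :
  continuous f x -> continuous g x -> continuous (fun y => f y * g y) x.
Proof. exact (continuous_mult f g x). Qed.
Lemma continuous_Ropp {T : UniformSpace} (f : T -> R) x :
  continuous f x -> continuous (fun y => - f y) x.
Proof. exact (continuous_opp f x). Qed.
Lemma continuous_Rminus {T : UniformSpace} (f g : T -> R) x :
  continuous f x -> continuous g x -> continuous (fun y => f y - g y) x.
Proof. intros; apply continuous_Rplus; auto; apply continuous_Ropp; auto. Qed.

Lemma continuity_2d_pt_of_continuous (F : R * R -> R) x y :
  continuous F (x, y) -> continuity_2d_pt (fun u v => F (u, v)) x y.
Proof.
  intros H. apply continuity_2d_pt_filterlim.
  change (continuous (fun z : R * R => F (fst z, snd z)) (x, y)).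
  apply (continuous_ext F); [intros [a b]; reflexivity | exact H].
Qed.

Lemma differentiable_pt_lim_of_pd (F : R * R -> R) (r : R * R) :
  locally r (fun u => ex_derive (fun z => F (z, snd u)) (fst u)) ->
  ex_derive (fun z => F (fst r, z)) (snd r) ->
  continuous (pd1 F) r ->
  differentiable_pt_lim (fun u v => F (u, v)) (fst r) (snd r) (pd1 F r) (pd2 F r).
Proof.
  intros H1 H2 H3. apply filterdiff_differentiable_pt_lim.
  eapply filterdiff_ext_lin.
  - apply (is_derive_filterdiff (fun u v => F (u, v)) (fst r) (snd r)
             (fun u v => pd1 F (u, v)) (pd2 F r)).
    + destruct r as [r1 r2].
      apply (filter_imp (fun u => ex_derive (fun z => F (z, snd u)) (fst u))); auto.
      intros [a b] Hab. apply Derive_correct. auto.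
    + destruct r; apply Derive_correct; auto.
    + apply (continuous_ext (pd1 F)); [intros [a b]; reflexivity |]. destruct r; auto.
  - intros y. destruct r; reflexivity.
Qed.

(* Chain rule in the plane: one continuous partial derivative suffices. *)
Lemma is_derive_comp_pd (F : R * R -> R) (q1 q2 : R -> R) t0 dq1 dq2 :
  locally (q1 t0, q2 t0) (fun u => ex_derive (fun z => F (z, snd u)) (fst u)) ->
  ex_derive (fun z => F (q1 t0, z)) (q2 t0) ->
  continuous (pd1 F) (q1 t0, q2 t0) ->
  is_derive q1 t0 dq1 -> is_derive q2 t0 dq2 ->
  is_derive (fun t => F (q1 t, q2 t)) t0
    (pd1 F (q1 t0, q2 t0) * dq1 + pd2 F (q1 t0, q2 t0) * dq2).
Proof.
  intros H1 H2 H3 D1 D2. apply is_derive_Reals.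
  apply (derivable_pt_lim_comp_2d (fun u v => F (u, v)) q1 q2 t0);
    [apply (differentiable_pt_lim_of_pd F (q1 t0, q2 t0)); auto
    | apply is_derive_Reals; auto | apply is_derive_Reals; auto].
Qed.

Lemma is_derive_mult_const (h : R -> R) x l c :
  is_derive h x l -> is_derive (fun t => h t * c) x (l * c).
Proof.
  intros H. replace (l * c) with (l * c + h x * 0) by ring.
  apply (is_derive_mult h (fun _ => c)); auto; [exact (is_derive_const c x) | intros; apply Rmult_comm].
Qed.

(* [pd2 F r] is convertible to [pd1 (fun w => F (swap2 w)) (swap2 r)], so statements about the
   second coordinate are obtained from those about the first by transport along [swap2]. *)
Definition swap2 (r : R * R) : R * R := (snd r, fst r).

Lemma open_swap2 (U : R * R -> Prop) : open U -> open (fun w => U (swap2 w)).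
Proof.
  intros HU [x y] Hw.
  apply (continuous_pair (fun w : R * R => snd w) (fun w : R * R => fst w) (x, y));
    [apply continuous_snd_pt | apply continuous_fst_pt | apply HU, Hw].
Qed.

Lemma convex_swap2 (U : R * R -> Prop) : convex_set U -> convex_set (fun w => U (swap2 w)).
Proof. intros Hcv x y t Hx Hy Ht. exact (Hcv (swap2 x) (swap2 y) t Hx Hy Ht). Qed.

Section Regularity.
Variable U : R * R -> Prop.
Hypothesis HU : open U.
Implicit Types F G : R * R -> R.

Lemma locally_fst r : U r -> locally (fst r) (fun t => U (t, snd r)).
Proof.
  intros Hr. apply (locally_2d_1d_const_y (fun u v => U (u, v))).
  apply locally_2d_locally. destruct r.
  apply (filter_imp U); [intros [a b]; auto | apply HU; auto].
Qed.

Lemma locally_snd r : U r -> locally (snd r) (fun t => U (fst r, t)).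
Proof.
  intros Hr. apply (locally_2d_1d_const_x (fun u v => U (u, v))).
  apply locally_2d_locally. destruct r.
  apply (filter_imp U); [intros [a b]; auto | apply HU; auto].
Qed.

Section Ext.
Variables F G : R * R -> R.
Hypothesis HFG : forall r, U r -> F r = G r.

Lemma pd1_ext_on r : U r -> pd1 F r = pd1 G r.
Proof.
  intros Hr. apply Derive_ext_loc.
  apply (filter_imp (fun t => U (t, snd r))); [intros; apply HFG; auto | apply locally_fst; auto].
Qed.

Lemma pd2_ext_on r : U r -> pd2 F r = pd2 G r.
Proof.
  intros Hr. apply Derive_ext_loc.
  apply (filter_imp (fun t => U (fst r, t))); [intros; apply HFG; auto | apply locally_snd; auto].
Qed.

Lemma ex_derive1_ext_on r : U r ->
  ex_derive (fun t => F (t, snd r)) (fst r) -> ex_derive (fun t => G (t, snd r)) (fst r).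
Proof.
  intros Hr. apply ex_derive_ext_loc.
  apply (filter_imp (fun t => U (t, snd r))); [intros; apply HFG; auto | apply locally_fst; auto].
Qed.

Lemma ex_derive2_ext_on r : U r ->
  ex_derive (fun t => F (fst r, t)) (snd r) -> ex_derive (fun t => G (fst r, t)) (snd r).
Proof.
  intros Hr. apply ex_derive_ext_loc.
  apply (filter_imp (fun t => U (fst r, t))); [intros; apply HFG; auto | apply locally_snd; auto].
Qed.

Lemma continuous_ext_on r : U r -> continuous F r -> continuous G r.
Proof.
  intros Hr. apply continuous_ext_loc.
  apply (filter_imp U); [intros y Hy; apply HFG; auto | apply HU; auto].
Qed.

End Ext.

Lemma Ck_ext n : forall F G, (forall r, U r -> F r = G r) -> Ck U n F -> Ck U n G.
Proof.
  induction n; intros F G H HF; simpl in *.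
  - intros r Hr. apply (continuous_ext_on F); auto.
  - destruct HF as [Hd [H0 [H1 H2]]]. repeat split.
    + apply (ex_derive1_ext_on F); auto. apply Hd; auto.
    + apply (ex_derive2_ext_on F); auto. apply Hd; auto.
    + apply (IHn F); auto.
    + apply (IHn (pd1 F)); auto. intros; apply pd1_ext_on; auto.
    + apply (IHn (pd2 F)); auto. intros; apply pd2_ext_on; auto.
Qed.

Lemma Ck_continuous n F r : Ck U n F -> U r -> continuous F r.
Proof. revert F; induction n; intros F HF Hr; simpl in *; auto. apply IHn; tauto. Qed.

Lemma Ck_const n : forall c, Ck U n (fun _ => c).
Proof.
  induction n; intro c; simpl.
  - intros; apply continuous_const.
  - repeat split; auto; try apply ex_derive_const;
      apply (Ck_ext n (fun _ => 0)); auto; intros; symmetry;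
      [unfold pd1 | unfold pd2]; apply Derive_const.
Qed.

Lemma Ck_plus n : forall F G, Ck U n F -> Ck U n G -> Ck U n (fun r => F r + G r).
Proof.
  induction n; intros F G HF HG; simpl in *.
  - intros r Hr. apply continuous_Rplus; auto.
  - destruct HF as [Fd [F0 [F1 F2]]], HG as [Gd [G0 [G1 G2]]].
    repeat split; auto.
    + apply (ex_derive_plus (fun t => F (t, snd r)) (fun t => G (t, snd r))); [apply Fd | apply Gd]; auto.
    + apply (ex_derive_plus (fun t => F (fst r, t)) (fun t => G (fst r, t))); [apply Fd | apply Gd]; auto.
    + apply (Ck_ext n (fun r => pd1 F r + pd1 G r)); auto.
      intros r Hr; unfold pd1. rewrite Derive_plus; auto; [apply Fd | apply Gd]; auto.
    + apply (Ck_ext n (fun r => pd2 F r + pd2 G r)); auto.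
      intros r Hr; unfold pd2. rewrite Derive_plus; auto; [apply Fd | apply Gd]; auto.
Qed.

Lemma Ck_opp n : forall F, Ck U n F -> Ck U n (fun r => - F r).
Proof.
  induction n; intros F HF; simpl in *.
  - intros r Hr. apply continuous_Ropp; auto.
  - destruct HF as [Fd [F0 [F1 F2]]].
    repeat split; auto.
    + apply (ex_derive_opp (fun t => F (t, snd r))); apply Fd; auto.
    + apply (ex_derive_opp (fun t => F (fst r, t))); apply Fd; auto.
    + apply (Ck_ext n (fun r => - pd1 F r)); auto.
      intros r Hr; unfold pd1. rewrite Derive_opp; auto.
    + apply (Ck_ext n (fun r => - pd2 F r)); auto.
      intros r Hr; unfold pd2. rewrite Derive_opp; auto.
Qed.

Lemma Ck_mult n : forall F G, Ck U n F -> Ck U n G -> Ck U n (fun r => F r * G r).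
Proof.
  induction n; intros F G HF HG.
  - intros r Hr. apply continuous_Rmult; [apply HF | apply HG]; auto.
  - destruct HF as [Fd [F0 [F1 F2]]], HG as [Gd [G0 [G1 G2]]].
    simpl. repeat split; auto.
    + apply (ex_derive_mult (fun t => F (t, snd r)) (fun t => G (t, snd r))); [apply Fd | apply Gd]; auto.
    + apply (ex_derive_mult (fun t => F (fst r, t)) (fun t => G (fst r, t))); [apply Fd | apply Gd]; auto.
    + apply (Ck_ext n (fun r => pd1 F r * G r + F r * pd1 G r)); [| apply Ck_plus; auto].
      intros r Hr; unfold pd1. rewrite Derive_mult; [destruct r; reflexivity | apply Fd | apply Gd]; auto.
    + apply (Ck_ext n (fun r => pd2 F r * G r + F r * pd2 G r)); [| apply Ck_plus; auto].
      intros r Hr; unfold pd2. rewrite Derive_mult; [destruct r; reflexivity | apply Fd | apply Gd]; auto.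
Qed.

Lemma Ck_inv n : forall F, Ck U n F -> (forall r, U r -> F r <> 0) -> Ck U n (fun r => / F r).
Proof.
  induction n; intros F HF Hnz.
  - intros r Hr. apply (continuous_comp F Rinv); [apply HF; auto |].
    apply continuity_pt_filterlim, continuity_pt_inv; [apply continuity_pt_id | auto].
  - destruct HF as [Fd [F0 [F1 F2]]].
    simpl. repeat split; auto.
    + apply (ex_derive_inv (fun t => F (t, snd r))); [apply Fd; auto | destruct r; apply Hnz; auto].
    + apply (ex_derive_inv (fun t => F (fst r, t))); [apply Fd; auto | destruct r; apply Hnz; auto].
    + apply (Ck_ext n (fun r => - (pd1 F r * (/ F r * / F r))));
        [| apply Ck_opp, Ck_mult, Ck_mult; auto].
      intros r Hr; unfold pd1. rewrite Derive_inv; [| apply Fd; auto | destruct r; apply Hnz; auto].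
      destruct r; simpl. field. apply Hnz; auto.
    + apply (Ck_ext n (fun r => - (pd2 F r * (/ F r * / F r))));
        [| apply Ck_opp, Ck_mult, Ck_mult; auto].
      intros r Hr; unfold pd2. rewrite Derive_inv; [| apply Fd; auto | destruct r; apply Hnz; auto].
      destruct r; simpl. field. apply Hnz; auto.
Qed.

Lemma Ck_sumk n m : forall (F : nat -> R * R -> R),
  (forall i, (i < m)%nat -> Ck U n (F i)) -> Ck U n (fun r => sumk m (fun i => F i r)).
Proof.
  induction m; intros F H.
  - apply (Ck_ext n (fun _ => 0)); [reflexivity | apply Ck_const].
  - apply (Ck_ext n (fun r => sumk m (fun i => F i r) + F m r));
      [intros; rewrite sumk_S; reflexivity | apply Ck_plus; auto].
Qed.

Lemma smooth_on_ext F G : (forall r, U r -> F r = G r) -> smooth_on U F -> smooth_on U G.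
Proof. intros H HF n. apply (Ck_ext n F); auto. Qed.
Lemma smooth_on_const c : smooth_on U (fun _ => c).
Proof. intros n; apply Ck_const. Qed.
Lemma smooth_on_plus F G : smooth_on U F -> smooth_on U G -> smooth_on U (fun r => F r + G r).
Proof. intros; intro n; apply Ck_plus; auto. Qed.
Lemma smooth_on_opp F : smooth_on U F -> smooth_on U (fun r => - F r).
Proof. intros; intro n; apply Ck_opp; auto. Qed.
Lemma smooth_on_minus F G : smooth_on U F -> smooth_on U G -> smooth_on U (fun r => F r - G r).
Proof. intros; apply smooth_on_plus, smooth_on_opp; auto. Qed.
Lemma smooth_on_mult F G : smooth_on U F -> smooth_on U G -> smooth_on U (fun r => F r * G r).
Proof. intros; intro n; apply Ck_mult; auto. Qed.
Lemma smooth_on_inv F : smooth_on U F -> (forall r, U r -> F r <> 0) -> smooth_on U (fun r => / F r).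
Proof. intros; intro n; apply Ck_inv; auto. Qed.
Lemma smooth_on_sumk m (F : nat -> R * R -> R) :
  (forall i, (i < m)%nat -> smooth_on U (F i)) -> smooth_on U (fun r => sumk m (fun i => F i r)).
Proof. intros H n; apply Ck_sumk; intros; apply H; auto. Qed.
Lemma smooth_on_pd1 F : smooth_on U F -> smooth_on U (pd1 F).
Proof. intros H n. apply (H (S n)). Qed.
Lemma smooth_on_pd2 F : smooth_on U F -> smooth_on U (pd2 F).
Proof. intros H n. apply (H (S n)). Qed.
Lemma smooth_on_dd al F : smooth_on U F -> smooth_on U (dd al F).
Proof. destruct al; [apply smooth_on_pd1 | apply smooth_on_pd2]. Qed.

Section C1.
Variable F : R * R -> R.
Hypothesis HF : C1_on U F.

Lemma C1_on_continuous r : U r -> continuous F r.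
Proof. apply (Ck_continuous 1); auto. Qed.
Lemma C1_on_ex_derive1 r : U r -> ex_derive (fun t => F (t, snd r)) (fst r).
Proof. intros Hr. exact (proj1 (proj1 HF r Hr)). Qed.
Lemma C1_on_ex_derive2 r : U r -> ex_derive (fun t => F (fst r, t)) (snd r).
Proof. intros Hr. exact (proj2 (proj1 HF r Hr)). Qed.
Lemma C1_on_continuous_pd1 r : U r -> continuous (pd1 F) r.
Proof. exact (proj1 (proj2 (proj2 HF)) r). Qed.
Lemma C1_on_continuous_pd2 r : U r -> continuous (pd2 F) r.
Proof. exact (proj2 (proj2 (proj2 HF)) r). Qed.

Lemma is_derive_comp_C1 (q1 q2 : R -> R) t0 dq1 dq2 :
  U (q1 t0, q2 t0) -> is_derive q1 t0 dq1 -> is_derive q2 t0 dq2 ->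
  is_derive (fun t => F (q1 t, q2 t)) t0
    (pd1 F (q1 t0, q2 t0) * dq1 + pd2 F (q1 t0, q2 t0) * dq2).
Proof.
  intros Hq D1 D2. apply is_derive_comp_pd; auto.
  - apply (filter_imp U); [intros u Hu; apply C1_on_ex_derive1; auto | apply HU; auto].
  - apply (C1_on_ex_derive2 (q1 t0, q2 t0)); auto.
  - apply C1_on_continuous_pd1; auto.
Qed.

End C1.

End Regularity.

Lemma Ck_swap2 (U : R * R -> Prop) n : forall F,
  Ck U n F -> Ck (fun w => U (swap2 w)) n (fun w => F (swap2 w)).
Proof.
  induction n; intros F HF; simpl in *.
  - intros [x y] Hw. apply (continuous_comp swap2 F);
      [apply continuous_pair; [apply continuous_snd_pt | apply continuous_fst_pt] | apply HF, Hw].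
  - destruct HF as [Hd [H0 [H1 H2]]]. split; [| split; [| split]].
    + intros [x y] Hw. destruct (Hd (y, x) Hw). split; assumption.
    + apply IHn; auto.
    + apply (IHn (pd2 F)); auto.
    + apply (IHn (pd1 F)); auto.
Qed.

Lemma C1_on_swap2 U F : C1_on U F -> C1_on (fun w => U (swap2 w)) (fun w => F (swap2 w)).
Proof. apply Ck_swap2. Qed.

(** * The Poincare lemma on a convex domain *)

Definition segment (c r : R * R) (t : R) : R * R :=
  (t * fst r + (1 - t) * fst c, t * snd r + (1 - t) * snd c).

(* The potential of the form a dr^1 + b dr^2, integrated along the segment from c to r. *)
Definition radial_potential (c : R * R) (a b : R * R -> R) (r : R * R) : R :=
  RInt (fun t => a (segment c r t) * (fst r - fst c) + b (segment c r t) * (snd r - snd c)) 0 1.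

Lemma segment_1 c r : segment c r 1 = r.
Proof. destruct r; unfold segment; simpl; f_equal; ring. Qed.

Lemma continuous_affine (t0 a b : R) : continuous (fun t : R => a * t + b) t0.
Proof.
  apply continuity_pt_filterlim, derivable_continuous_pt.
  apply derivable_pt_plus; [apply derivable_pt_scal, derivable_pt_id | apply derivable_pt_const].
Qed.

Lemma continuous_segment c r t0 : continuous (segment c r) t0.
Proof.
  apply continuous_pair.
  - apply (continuous_ext (fun t => (fst r - fst c) * t + fst c));
      [intros; simpl; ring | apply continuous_affine].
  - apply (continuous_ext (fun t => (snd r - snd c) * t + snd c));
      [intros; simpl; ring | apply continuous_affine].
Qed.

Lemma continuous_segment_param1 c y w0 :
  continuous (fun w : R * R => segment c (fst w, y) (snd w)) w0.
Proof.
  unfold segment; cbn [fst snd].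
  apply continuous_pair; apply continuous_Rplus; apply continuous_Rmult;
    first [ apply continuous_snd_pt | apply continuous_fst_pt | apply continuous_const
          | apply continuous_Rminus; [apply continuous_const | apply continuous_snd_pt] ].
Qed.

Section Poincare.
Variable U : R * R -> Prop.
Hypothesis HU : open U.
Hypothesis Hcv : convex_set U.
Variable c : R * R.
Hypothesis Hc : U c.
Variables a b : R * R -> R.
Hypothesis Ha : C1_on U a.
Hypothesis Hb : C1_on U b.
Hypothesis Hclosed : forall r, U r -> pd2 a r = pd1 b r.

Lemma segment_in r t : U r -> 0 <= t <= 1 -> U (segment c r t).
Proof. intros Hr Ht. apply Hcv; auto. Qed.

Lemma continuous_comp_C1 (F : R * R -> R) {T : UniformSpace} (h : T -> R * R) w0 :
  C1_on U F -> U (h w0) -> continuous h w0 -> continuous (fun w => F (h w)) w0.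
Proof. intros HF Hw Hh. apply (continuous_comp h F); auto. apply (C1_on_continuous U); auto. Qed.

Lemma continuous_comp_pd1 (F : R * R -> R) {T : UniformSpace} (h : T -> R * R) w0 :
  C1_on U F -> U (h w0) -> continuous h w0 -> continuous (fun w => pd1 F (h w)) w0.
Proof. intros HF Hw Hh. apply (continuous_comp h (pd1 F)); auto. apply (C1_on_continuous_pd1 U); auto. Qed.

Lemma continuous_comp_pd2 (F : R * R -> R) {T : UniformSpace} (h : T -> R * R) w0 :
  C1_on U F -> U (h w0) -> continuous h w0 -> continuous (fun w => pd2 F (h w)) w0.
Proof. intros HF Hw Hh. apply (continuous_comp h (pd2 F)); auto. apply (C1_on_continuous_pd2 U); auto. Qed.

Let integrand y u t := a (segment c (u, y) t) * (u - fst c) + b (segment c (u, y) t) * (y - snd c).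

Let d_integrand y u t :=
  t * pd1 a (segment c (u, y) t) * (u - fst c) + a (segment c (u, y) t)
  + t * pd1 b (segment c (u, y) t) * (y - snd c).

Lemma is_derive_integrand y u t : U (segment c (u, y) t) ->
  is_derive (fun z => integrand y z t) u (d_integrand y u t).
Proof.
  intros Hg. unfold integrand.
  assert (Hseg : forall F, ex_derive (fun s => F (s, snd (segment c (u, y) t)))
                   (fst (segment c (u, y) t)) -> is_derive (fun z => F (segment c (z, y) t)) u
                   (t * pd1 F (segment c (u, y) t))).
  { intros F HF. unfold segment at 1; cbn [fst snd].
    apply (is_derive_comp (fun s => F (s, t * y + (1 - t) * snd c)) (fun z => t * z + (1 - t) * fst c));
      [apply Derive_correct, HF | auto_derive; auto; ring]. }
  replace (d_integrand y u t) with
    (t * pd1 a (segment c (u, y) t) * (u - fst c) + a (segment c (u, y) t) * 1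
     + t * pd1 b (segment c (u, y) t) * (y - snd c)) by (unfold d_integrand; ring).
  apply (is_derive_plus (fun z => a (segment c (z, y) t) * (z - fst c))
                        (fun z => b (segment c (z, y) t) * (y - snd c))).
  - apply (is_derive_mult (fun z => a (segment c (z, y) t)) (fun z => z - fst c));
      [apply Hseg, (C1_on_ex_derive1 U); auto | auto_derive; auto; ring
      | intros; apply Rmult_comm].
  - apply is_derive_mult_const, Hseg, (C1_on_ex_derive1 U); auto.
Qed.

Lemma continuity_d_integrand y x t : U (segment c (x, y) t) ->
  continuity_2d_pt (d_integrand y) x t.
Proof.
  intros Hg. apply (continuity_2d_pt_of_continuous (fun w => d_integrand y (fst w) (snd w))).
  unfold d_integrand.
  assert (G : U ((fun w : R * R => segment c (fst w, y) (snd w)) (x, t))) by exact Hg.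
  assert (CG := continuous_segment_param1 c y (x, t)).
  apply continuous_Rplus; [apply continuous_Rplus |].
  - apply continuous_Rmult;
      [apply continuous_Rmult; [apply continuous_snd_pt | apply continuous_comp_pd1; auto]
      | apply continuous_Rminus; [apply continuous_fst_pt | apply continuous_const]].
  - apply continuous_comp_C1; auto.
  - apply continuous_Rmult;
      [apply continuous_Rmult; [apply continuous_snd_pt | apply continuous_comp_pd1; auto]
      | apply continuous_const].
Qed.

(* Closedness makes [d_integrand] the t-derivative of [t a(segment t)]. *)
Lemma is_RInt_d_integrand x y : U (x, y) -> is_RInt (d_integrand y x) 0 1 (a (x, y)).
Proof.
  intros Hr.
  set (h := fun t => t * a (segment c (x, y) t)).
  apply (is_RInt_ext (fun t => 1 * a (segment c (x, y) t)
     + t * (pd1 a (segment c (x, y) t) * (x - fst c) + pd2 a (segment c (x, y) t) * (y - snd c)))).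
  { rewrite Rmin_left, Rmax_right by lra. intros t Ht.
    assert (Hg : U (segment c (x, y) t)) by (apply segment_in; auto; lra).
    unfold d_integrand. rewrite (Hclosed _ Hg). ring_R. }
  replace (a (x, y)) with (minus (h 1) (h 0))
    by (unfold h, minus, plus, opp; simpl; rewrite segment_1; ring).
  apply (is_RInt_derive (V := R_CompleteNormedModule) h); rewrite Rmin_left, Rmax_right by lra;
    intros t Ht; assert (Hg : U (segment c (x, y) t)) by (apply segment_in; auto).
  - apply (is_derive_mult (fun t => t) (fun t => a (segment c (x, y) t)));
      [exact (is_derive_id t) | | intros; apply Rmult_comm].
    unfold segment at 1; cbn [fst snd].
    apply (is_derive_comp_C1 U HU a Ha); auto; auto_derive; auto; ring.
  - apply continuous_Rplus;
      [apply continuous_Rmult; [apply continuous_const | apply continuous_comp_C1]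
      | apply continuous_Rmult; [apply continuous_id | apply continuous_Rplus; apply continuous_Rmult;
          [apply continuous_comp_pd1 | apply continuous_const | apply continuous_comp_pd2 | apply continuous_const]]];
      auto; apply continuous_segment.
Qed.

Lemma is_derive_radial_potential1 x y : U (x, y) ->
  is_derive (fun u => radial_potential c a b (u, y)) x (a (x, y)).
Proof.
  intros Hr.
  assert (Hloc : locally x (fun u => U (u, y))) by exact (locally_fst U HU (x, y) Hr).
  assert (P := is_derive_RInt_param (integrand y) 0 1 x).
  rewrite Rmin_left, Rmax_right in P by lra.
  replace (a (x, y)) with (RInt (fun t => Derive (fun u => integrand y u t) x) 0 1).
  - apply P.
    + apply (filter_imp (fun u => U (u, y))); auto.
      intros u Hu t Ht. eexists. apply is_derive_integrand, segment_in; auto.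
    + intros t Ht. apply (continuity_2d_pt_ext_loc (d_integrand y));
        [| apply continuity_d_integrand, segment_in; auto].
      apply locally_2d_locally.
      apply (filter_imp (fun w : R * R => U (segment c (fst w, y) (snd w)))).
      * intros [u v] Huv. symmetry. apply is_derive_unique, is_derive_integrand; auto.
      * apply (continuous_segment_param1 c y (x, t)), HU, segment_in; auto.
    + apply (filter_imp (fun u => U (u, y))); auto.
      intros u Hu. apply (ex_RInt_continuous (V := R_CompleteNormedModule)).
      rewrite Rmin_left, Rmax_right by lra. intros z Hz.
      apply continuous_Rplus; apply continuous_Rmult; try apply continuous_const;
        apply continuous_comp_C1; auto; [apply segment_in | apply continuous_segment
        | apply segment_in | apply continuous_segment]; auto.
  - rewrite (RInt_ext _ (d_integrand y x)).
    + apply is_RInt_unique, is_RInt_d_integrand; auto.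
    + rewrite Rmin_left, Rmax_right by lra. intros t Ht.
      apply is_derive_unique, is_derive_integrand, segment_in; auto; lra.
Qed.

End Poincare.

Lemma radial_potential_swap2 c a b r :
  radial_potential (swap2 c) (fun w => b (swap2 w)) (fun w => a (swap2 w)) (swap2 r)
  = radial_potential c a b r.
Proof.
  unfold radial_potential. apply RInt_ext. intros t _.
  unfold swap2, segment. cbn [fst snd]. ring_R.
Qed.

Section Potential.
Variable U : R * R -> Prop.
Hypothesis HU : open U.
Hypothesis Hcv : convex_set U.
Variable c : R * R.
Hypothesis Hc : U c.
Variables a b : R * R -> R.
Hypothesis Ha : C1_on U a.
Hypothesis Hb : C1_on U b.
Hypothesis Hclosed : forall r, U r -> pd2 a r = pd1 b r.

Let phi := radial_potential c a b.

Lemma is_derive_radial_potential2 x y : U (x, y) ->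
  is_derive (fun u => phi (x, u)) y (b (x, y)).
Proof.
  intros Hr.
  apply (is_derive_ext (fun u => radial_potential (swap2 c) (fun w => b (swap2 w))
                                   (fun w => a (swap2 w)) (u, x)));
    [intros u; apply (radial_potential_swap2 c a b (x, u)) |].
  assert (Hcl' : forall w, U (swap2 w) ->
            pd2 (fun w => b (swap2 w)) w = pd1 (fun w => a (swap2 w)) w).
  { intros [u v] Hw. symmetry. apply (Hclosed (v, u) Hw). }
  assert (Hc' : U (swap2 (swap2 c))) by (destruct c; exact Hc).
  exact (is_derive_radial_potential1 (fun w => U (swap2 w)) (open_swap2 U HU)
           (convex_swap2 U Hcv) (swap2 c) Hc' _ _ (C1_on_swap2 U b Hb) (C1_on_swap2 U a Ha)
           Hcl' y x Hr).
Qed.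

Lemma pd1_radial_potential r : U r -> pd1 phi r = a r.
Proof.
  destruct r as [x y]; intros Hr.
  exact (is_derive_unique _ _ _ (is_derive_radial_potential1 U HU Hcv c Hc a b Ha Hb Hclosed x y Hr)).
Qed.

Lemma pd2_radial_potential r : U r -> pd2 phi r = b r.
Proof.
  destruct r as [x y]; intros Hr.
  exact (is_derive_unique _ _ _ (is_derive_radial_potential2 x y Hr)).
Qed.

Lemma C1_on_radial_potential : C1_on U phi.
Proof.
  assert (Hd : forall r, U r -> exd 0 phi r /\ exd 1 phi r).
  { intros [x y] Hr. split; eexists;
      [exact (is_derive_radial_potential1 U HU Hcv c Hc a b Ha Hb Hclosed x y Hr)
      | exact (is_derive_radial_potential2 x y Hr)]. }
  assert (Hpd1 : forall r, U r -> continuous (pd1 phi) r).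
  { intros r Hr. apply (continuous_ext_on U HU a); [intros; symmetry; apply pd1_radial_potential; auto | auto |].
    apply (C1_on_continuous U); auto. }
  split; [exact Hd | split; [| split]]; simpl; auto.
  - intros [x y] Hr.
    assert (Dp := differentiable_pt_lim_of_pd phi (x, y)).
    apply (continuous_ext (fun z : R * R => phi (fst z, snd z))); [intros [u v]; reflexivity |].
    apply (continuity_2d_pt_filterlim (fun u v => phi (u, v))), differentiable_continuity_pt.
    exists (pd1 phi (x, y)), (pd2 phi (x, y)). apply Dp; auto.
    + apply (filter_imp U); [intros u Hu; apply (Hd u Hu) | apply HU; auto].
    + apply (Hd (x, y) Hr).
  - intros r Hr. apply (continuous_ext_on U HU b); [intros; symmetry; apply pd2_radial_potential; auto | auto |].
    apply (C1_on_continuous U); auto.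
Qed.

End Potential.

Lemma C1_on_exp (U : R * R -> Prop) (phi : R * R -> R) : open U -> C1_on U phi ->
  C1_on U (fun r => exp (phi r)) /\
  forall r, U r -> pd1 (fun r => exp (phi r)) r = pd1 phi r * exp (phi r)
           /\ pd2 (fun r => exp (phi r)) r = pd2 phi r * exp (phi r).
Proof.
  intros HU Hphi.
  assert (Hcont : forall r, U r -> continuous (fun r => exp (phi r)) r)
    by (intros r Hr; apply (continuous_comp phi exp r); [apply (C1_on_continuous U); auto | apply continuous_exp]).
  assert (Hpd : forall r, U r -> pd1 (fun r => exp (phi r)) r = pd1 phi r * exp (phi r)
                            /\ pd2 (fun r => exp (phi r)) r = pd2 phi r * exp (phi r)).
  { intros [x y] Hr. unfold pd1, pd2; cbn [fst snd]. split.
    - set (q := fun t => phi (t, y)). change (Derive (fun t => exp (q t)) x = Derive q x * exp (q x)).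
      apply is_derive_unique; auto_derive; [apply (C1_on_ex_derive1 U phi Hphi (x, y) Hr) | now rewrite Rmult_1_l].
    - set (q := fun t => phi (x, t)). change (Derive (fun t => exp (q t)) y = Derive q y * exp (q y)).
      apply is_derive_unique; auto_derive; [apply (C1_on_ex_derive2 U phi Hphi (x, y) Hr) | now rewrite Rmult_1_l]. }
  split; [| exact Hpd].
  split; [| split; [| split]]; simpl; auto.
  - intros r Hr. split.
    + apply (ex_derive_comp exp (fun t => phi (t, snd r)));
        [apply ex_derive_Reals_1, derivable_pt_exp | apply (C1_on_ex_derive1 U); auto].
    + apply (ex_derive_comp exp (fun t => phi (fst r, t)));
        [apply ex_derive_Reals_1, derivable_pt_exp | apply (C1_on_ex_derive2 U); auto].
  - intros r Hr. apply (continuous_ext_on U HU (fun w => pd1 phi w * exp (phi w)));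
      [intros; symmetry; apply Hpd; auto | auto |].
    apply continuous_Rmult; [apply (C1_on_continuous_pd1 U); auto | auto].
  - intros r Hr. apply (continuous_ext_on U HU (fun w => pd2 phi w * exp (phi w)));
      [intros; symmetry; apply Hpd; auto | auto |].
    apply continuous_Rmult; [apply (C1_on_continuous_pd2 U); auto | auto].
Qed.

(** * Rescaling the momenta, and integrability *)

Definition rescale (f : R * R -> R) (r p : R * R) : R * R := (f r * fst p, f r * snd p).

Lemma locally_lift_fst (P : R -> Prop) x y :
  locally x P -> locally (x, y) (fun u : R * R => P (fst u)).
Proof.
  intros [eps H]. apply (locally_2d_locally (fun u v => P u)).
  exists eps. intros u v Hu _. apply H, Hu.
Qed.

Lemma phase_C1_swap2 U g : phase_C1 U g ->
  phase_C1 (fun w => U (swap2 w)) (fun w p => g (swap2 w) p).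
Proof.
  intros Hg r p Hr. destruct (Hg (swap2 r) p Hr) as [Hc Hal].
  assert (Hsw : continuous (fun z : (R * R) * (R * R) => (swap2 (fst z), snd z)) (r, p)).
  { apply continuous_pair; [| apply continuous_snd_pt].
    apply continuous_pair;
      [apply (continuous_comp (fun z : (R * R) * (R * R) => fst z) snd)
      | apply (continuous_comp (fun z : (R * R) * (R * R) => fst z) fst)];
      apply continuous_fst_pt || apply continuous_snd_pt. }
  split; [apply (continuous_comp _ (uncurry2 g) (r, p) Hsw Hc) |].
  intros al Hal2.
  destruct (Hal 0%nat ltac:(lia)) as [E0 [F0 [C0 D0]]], (Hal 1%nat ltac:(lia)) as [E1 [F1 [C1 D1]]].
  destruct al as [| [| al]]; [| | lia]; repeat split;
    first [ assumption
          | apply (continuous_comp _ (uncurry2 (drP 1 g)) (r, p) Hsw C1)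
          | apply (continuous_comp _ (uncurry2 (drP 0 g)) (r, p) Hsw C0)
          | apply (continuous_comp _ (uncurry2 (dpP 0 g)) (r, p) Hsw D0)
          | apply (continuous_comp _ (uncurry2 (dpP 1 g)) (r, p) Hsw D1) ].
Qed.

Section Rescaling.
Variable U : R * R -> Prop.
Hypothesis HU : open U.
Variable g : R * R -> R * R -> R.
Hypothesis Hg : phase_C1 U g.
Variable f : R * R -> R.

Let G (r p : R * R) : R := g r (rescale f r p).

Lemma is_derive_comp_momentum r P (q1 q2 : R -> R) t0 dq1 dq2 :
  U r -> P = (q1 t0, q2 t0) -> is_derive q1 t0 dq1 -> is_derive q2 t0 dq2 ->
  is_derive (fun t => g r (q1 t, q2 t)) t0 (dpP 0 g r P * dq1 + dpP 1 g r P * dq2).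
Proof.
  intros Hr -> D1 D2.
  destruct (Hg r (q1 t0, q2 t0) Hr) as [_ H].
  apply (is_derive_comp_pd (fun w => g r w) q1 q2 t0 dq1 dq2); auto.
  - apply filter_forall. intros u. destruct (Hg r u Hr) as [_ Hu]. apply (Hu 0%nat); lia.
  - apply (H 1%nat); lia.
  - destruct (H 0%nat ltac:(lia)) as [_ [_ [_ Hc]]].
    apply (continuous_comp (fun w => (r, w)) (uncurry2 (dpP 0 g))); auto.
    apply continuous_pair; [apply continuous_const | apply continuous_id].
Qed.

Lemma dpP0_rescale r p : U r -> dpP 0 G r p = f r * dpP 0 g r (rescale f r p).
Proof.
  intros Hr. rewrite <- (Rplus_0_r (f r * _)).
  replace 0 with (dpP 1 g r (rescale f r p) * 0) by ring. rewrite Rmult_comm.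
  apply is_derive_unique.
  apply (is_derive_comp_momentum r _ (fun t => f r * t) (fun _ => f r * snd p)); auto;
    auto_derive; auto; ring.
Qed.

Lemma dpP1_rescale r p : U r -> dpP 1 G r p = f r * dpP 1 g r (rescale f r p).
Proof.
  intros Hr. rewrite <- (Rplus_0_l (f r * _)).
  replace 0 with (dpP 0 g r (rescale f r p) * 0) by ring. rewrite (Rmult_comm (f r)).
  apply is_derive_unique.
  apply (is_derive_comp_momentum r _ (fun _ => f r * fst p) (fun t => f r * t)); auto;
    auto_derive; auto; ring.
Qed.

Hypothesis Hf : C1_on U f.

(* Chain rule along the diagonal of [(s, t) |-> g (s, r2) (rescale f (t, r2) p)]. *)
Lemma drP0_rescale r p : U r ->
  drP 0 G r p = drP 0 g r (rescale f r p)
     + pd1 f r * (fst p * dpP 0 g r (rescale f r p) + snd p * dpP 1 g r (rescale f r p)).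
Proof.
  intros Hr. destruct r as [r1 r2].
  set (P := rescale f (r1, r2) p).
  set (Psi := fun w : R * R => g (fst w, r2) (rescale f (snd w, r2) p)).
  set (dPsi2 := dpP 0 g (r1, r2) P * (pd1 f (r1, r2) * fst p)
                + dpP 1 g (r1, r2) P * (pd1 f (r1, r2) * snd p)).
  assert (D2 : is_derive (fun s => Psi (r1, s)) r1 dPsi2).
  { apply (is_derive_comp_momentum (r1, r2) P (fun s => f (s, r2) * fst p) (fun s => f (s, r2) * snd p));
      auto; apply is_derive_mult_const, Derive_correct, (C1_on_ex_derive1 U f Hf (r1, r2)); auto. }
  assert (Dm : is_derive (fun t => Psi (t, t)) r1 (pd1 Psi (r1, r1) * 1 + pd2 Psi (r1, r1) * 1)).
  { apply (is_derive_comp_pd Psi (fun t => t) (fun t => t) r1 1 1);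
      [| exists dPsi2; exact D2 | | exact (is_derive_id r1) | exact (is_derive_id r1)].
    - apply (filter_imp (fun u : R * R => U (fst u, r2)));
        [| apply (locally_lift_fst (fun t => U (t, r2))), (locally_fst U HU (r1, r2)); auto].
      intros u Hu. destruct (Hg (fst u, r2) (rescale f (snd u, r2) p) Hu) as [_ H].
      apply (H 0%nat); lia.
    - apply (continuous_comp (fun w : R * R => ((fst w, r2), rescale f (snd w, r2) p)) (uncurry2 (drP 0 g)));
        [| destruct (Hg (r1, r2) P Hr) as [_ H]; apply (H 0%nat); lia].
      apply continuous_pair; [apply continuous_pair; [apply continuous_fst_pt | apply continuous_const] |].
      unfold rescale. apply continuous_pair; apply continuous_Rmult; try apply continuous_const;
        (apply (continuous_comp (fun w : R * R => (snd w, r2)) f);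
         [apply continuous_pair; [apply continuous_snd_pt | apply continuous_const]
         | apply (C1_on_continuous U); auto]). }
  replace (pd2 Psi (r1, r1)) with dPsi2 in Dm by (symmetry; apply is_derive_unique, D2).
  replace (drP 0 g (r1, r2) P + pd1 f (r1, r2) * (fst p * dpP 0 g (r1, r2) P + snd p * dpP 1 g (r1, r2) P))
    with (pd1 Psi (r1, r1) * 1 + dPsi2 * 1) by (unfold dPsi2; change (pd1 Psi (r1, r1)) with (drP 0 g (r1, r2) P); ring).
  apply is_derive_unique. exact Dm.
Qed.

End Rescaling.

Lemma drP1_rescale U g f (HU : open U) (Hg : phase_C1 U g) (Hf : C1_on U f) r p : U r ->
  drP 1 (fun r p => g r (rescale f r p)) r p = drP 1 g r (rescale f r p)
     + pd2 f r * (fst p * dpP 0 g r (rescale f r p) + snd p * dpP 1 g r (rescale f r p)).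
Proof.
  destruct r as [r1 r2]. intros Hr.
  exact (drP0_rescale (fun w => U (swap2 w)) (open_swap2 U HU) (fun w p => g (swap2 w) p)
           (phase_C1_swap2 U g Hg) (fun w => f (swap2 w)) (C1_on_swap2 U f Hf) (r2, r1) p Hr).
Qed.

Section Integrability.
Variable U : R * R -> Prop.
Hypothesis HU : open U.
Variables K1 K2 f : R * R -> R.
Hypothesis HK1 : C1_on U K1.
Hypothesis HK2 : C1_on U K2.
Hypothesis Hf : C1_on U f.
Hypothesis Hnz : forall r, U r -> f r <> 0.
Hypothesis E2 : forall r, U r -> pd2 f r = K1 r * f r.
Hypothesis E1 : forall r, U r -> pd1 f r = - K2 r * f r.

Lemma pd1_pd2_log_gradient r : U r -> pd1 (pd2 f) r = pd1 K1 r * f r + K1 r * (- K2 r * f r).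
Proof.
  intros Hr. rewrite (pd1_ext_on U HU (pd2 f) (fun w => K1 w * f w) E2 r Hr).
  unfold pd1 at 1. destruct r as [r1 r2]. rewrite Derive_mult.
  - rewrite <- E1; auto.
  - apply (C1_on_ex_derive1 U K1 HK1 (r1, r2)); auto.
  - apply (C1_on_ex_derive1 U f Hf (r1, r2)); auto.
Qed.

Lemma pd2_pd1_log_gradient r : U r -> pd2 (pd1 f) r = - (pd2 K2 r * f r + K2 r * (K1 r * f r)).
Proof.
  intros Hr.
  rewrite (pd2_ext_on U HU (pd1 f) (fun w => - (K2 w * f w))) by (auto; intros; rewrite E1; auto; ring).
  unfold pd2 at 1. destruct r as [r1 r2]. rewrite Derive_opp, Derive_mult.
  - rewrite <- E2; auto.
  - apply (C1_on_ex_derive2 U K2 HK2 (r1, r2)); auto.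
  - apply (C1_on_ex_derive2 U f Hf (r1, r2)); auto.
Qed.

(* Equality of the mixed partials of [f]. *)
Lemma closed_of_log_gradient r : U r -> pd1 K1 r = - pd2 K2 r.
Proof.
  intros Hr.
  assert (Hcont : forall F, C1_on U F -> continuous F r) by (intros; apply (C1_on_continuous U); auto).
  assert (S : pd1 (pd2 f) r = pd2 (pd1 f) r).
  { destruct r as [x y].
    apply (Schwarz (fun u v => f (u, v)) x y).
    - apply (locally_2d_impl (fun u v => U (u, v)));
        [| apply locally_2d_locally; apply (filter_imp U); [intros [u v]; auto | apply HU; auto]].
      apply locally_2d_forall. intros u v Huv. repeat split.
      + apply (C1_on_ex_derive1 U f Hf (u, v)); auto.
      + apply (C1_on_ex_derive2 U f Hf (u, v)); auto.
      + apply (ex_derive1_ext_on U HU (fun w => K1 w * f w) (pd2 f)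
                 (fun r Hr => eq_sym (E2 r Hr)) (u, v) Huv).
        apply (ex_derive_mult (fun t => K1 (t, v)) (fun t => f (t, v)));
          [apply (C1_on_ex_derive1 U K1 HK1 (u, v)) | apply (C1_on_ex_derive1 U f Hf (u, v))]; auto.
      + assert (E1' : forall r, U r -> - (K2 r * f r) = pd1 f r) by (intros; rewrite E1; auto; ring).
        apply (ex_derive2_ext_on U HU (fun w => - (K2 w * f w)) (pd1 f) E1' (u, v) Huv).
        apply (ex_derive_opp (fun t => K2 (u, t) * f (u, t))).
        apply (ex_derive_mult (fun t => K2 (u, t)) (fun t => f (u, t)));
          [apply (C1_on_ex_derive2 U K2 HK2 (u, v)) | apply (C1_on_ex_derive2 U f Hf (u, v))]; auto.
    - apply (continuity_2d_pt_of_continuous (pd1 (pd2 f))).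
      apply (continuous_ext_on U HU (fun w => pd1 K1 w * f w + K1 w * (- K2 w * f w)));
        [intros; symmetry; apply pd1_pd2_log_gradient; auto | auto |].
      apply continuous_Rplus; apply continuous_Rmult; auto;
        [apply (C1_on_continuous_pd1 U); auto | apply continuous_Rmult; auto; apply continuous_Ropp; auto].
    - apply (continuity_2d_pt_of_continuous (pd2 (pd1 f))).
      apply (continuous_ext_on U HU (fun w => - (pd2 K2 w * f w + K2 w * (K1 w * f w))));
        [intros; symmetry; apply pd2_pd1_log_gradient; auto | auto |].
      apply continuous_Ropp, continuous_Rplus; apply continuous_Rmult; auto;
        [apply (C1_on_continuous_pd2 U); auto | apply continuous_Rmult; auto]. }
  rewrite pd1_pd2_log_gradient, pd2_pd1_log_gradient in S; auto.
  assert (Hfr := Hnz r Hr).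
  apply (Rmult_eq_reg_r (f r)); auto. nra.
Qed.

End Integrability.

(** * The reduced Chaplygin system in coordinates *)

Section ReducedSystem.
Variable k : nat.
Variable C : nat -> nat -> nat -> R.
Variables gs gm gg : nat -> nat -> R * R -> R.
Variable V : R * R -> R.
Variable A : nat -> nat -> R * R -> R.

Local Notation Gm := (Gmat k gs gm gg V A).
Local Notation Gi := (Ginv k gs gm gg V A).
Local Notation det := (detG k gs gm gg V A).
Local Notation M := (Mm k gm gg A).
Local Notation B := (Bc k C A).

Definition lc_c00 r := / 2 * gs 0%nat 0%nat r - sumk k (fun a => gm a 0%nat r * A a 0%nat r)
  + / 2 * sumk k (fun a => sumk k (fun b => gg a b r * (A a 0%nat r * A b 0%nat r))).
Definition lc_c01 r := / 2 * (gs 0%nat 1%nat r + gs 1%nat 0%nat r)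
  - sumk k (fun a => gm a 0%nat r * A a 1%nat r + gm a 1%nat r * A a 0%nat r)
  + / 2 * sumk k (fun a => sumk k (fun b =>
        gg a b r * (A a 0%nat r * A b 1%nat r + A a 1%nat r * A b 0%nat r))).
Definition lc_c11 r := / 2 * gs 1%nat 1%nat r - sumk k (fun a => gm a 1%nat r * A a 1%nat r)
  + / 2 * sumk k (fun a => sumk k (fun b => gg a b r * (A a 1%nat r * A b 1%nat r))).

Lemma lc_quadratic r v :
  lc k gs gm gg V A r v
  = lc_c00 r * (fst v * fst v) + lc_c01 r * (fst v * snd v) + lc_c11 r * (snd v * snd v) - V r.
Proof.
  destruct v as [v0 v1]. unfold lc, lred, lc_c00, lc_c01, lc_c11. rewrite !sumk_2. cbn [cmp2 fst snd].
  rewrite (sumk_ext k (fun a => sumk 2 (fun al => gm a al r * cmp2 al (v0, v1) * xic A r (v0, v1) a))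
     (fun a => (v0 * v0) * (- (gm a 0%nat r * A a 0%nat r))
      + ((v0 * v1) * (- (gm a 0%nat r * A a 1%nat r + gm a 1%nat r * A a 0%nat r))
      + (v1 * v1) * (- (gm a 1%nat r * A a 1%nat r)))))
    by (intros; unfold xic; rewrite !sumk_2; cbn [cmp2 fst snd]; ring).
  rewrite (sumk_ext k (fun a => sumk k (fun b => gg a b r * xic A r (v0, v1) a * xic A r (v0, v1) b))
     (fun a => (v0 * v0) * sumk k (fun b => gg a b r * (A a 0%nat r * A b 0%nat r))
            + ((v0 * v1) * sumk k (fun b => gg a b r * (A a 0%nat r * A b 1%nat r + A a 1%nat r * A b 0%nat r))
            + (v1 * v1) * sumk k (fun b => gg a b r * (A a 1%nat r * A b 1%nat r))))).
  - rewrite !sumk_plus, !sumk_scal, !sumk_opp, ?sumk_plus. ring.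
  - intros a _. rewrite <- !sumk_scal, <- !sumk_plus. apply sumk_ext; intros.
    unfold xic; rewrite !sumk_2; cbn [cmp2 fst snd]; ring.
Qed.

Lemma Gmat_explicit al be r : Gm al be r =
  match al, be with
  | O, O => 2 * lc_c00 r
  | S _, S _ => 2 * lc_c11 r
  | _, _ => lc_c01 r
  end.
Proof.
  unfold Gmat.
  assert (L1 : forall v, pd1 (lc k gs gm gg V A r) v = 2 * lc_c00 r * fst v + lc_c01 r * snd v).
  { intros v. apply is_derive_unique.
    apply (is_derive_ext (fun t => lc_c00 r * (t * t) + lc_c01 r * (t * snd v)
                                   + lc_c11 r * (snd v * snd v) - V r));
      [intros; rewrite lc_quadratic; reflexivity | auto_derive; auto; ring]. }
  assert (L2 : forall v, pd2 (lc k gs gm gg V A r) v = lc_c01 r * fst v + 2 * lc_c11 r * snd v).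
  { intros v. apply is_derive_unique.
    apply (is_derive_ext (fun t => lc_c00 r * (fst v * fst v) + lc_c01 r * (fst v * t)
                                   + lc_c11 r * (t * t) - V r));
      [intros; rewrite lc_quadratic; reflexivity | auto_derive; auto; ring]. }
  destruct al, be; cbn [dd]; [unfold pd1 at 1 | unfold pd1 at 1 | unfold pd2 at 1 | unfold pd2 at 1];
    apply is_derive_unique; cbn [fst snd];
    [ apply (is_derive_ext (fun t => 2 * lc_c00 r * t + lc_c01 r * 0))
    | apply (is_derive_ext (fun t => lc_c01 r * t + 2 * lc_c11 r * 0))
    | apply (is_derive_ext (fun t => 2 * lc_c00 r * 0 + lc_c01 r * t))
    | apply (is_derive_ext (fun t => lc_c01 r * 0 + 2 * lc_c11 r * t)) ];
    try (intros; rewrite ?L1, ?L2; reflexivity); auto_derive; auto; ring.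
Qed.

Lemma Gmat_sym r : Gm 0 1 r = Gm 1 0 r.
Proof. rewrite !Gmat_explicit. reflexivity. Qed.

Lemma Ginv_sym r : Gi 0 1 r = Gi 1 0 r.
Proof. unfold Ginv. rewrite Gmat_sym. reflexivity. Qed.

Definition rvel (al : nat) (r p : R * R) : R := Gi al 0 r * fst p + Gi al 1 r * snd p.

Lemma rvel_Gmat r e : det r <> 0 ->
  rvel 0 r (Gm 0 e r, Gm 1 e r) = (if Nat.eqb e 0 then 1 else 0)
  /\ rvel 1 r (Gm 0 e r, Gm 1 e r) = (if Nat.eqb e 0 then 0 else 1).
Proof.
  intros Hd. unfold rvel, Ginv, detG in *. cbn [fst snd].
  destruct e; cbn [Nat.eqb]; [| change (Gm 0 (S e) r) with (Gm 0 1 r);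
                                  change (Gm 1 (S e) r) with (Gm 1 1 r)];
    split; field; auto.
Qed.

Lemma ham_explicit r p : det r <> 0 ->
  ham k gs gm gg V A r p
  = / 2 * (Gi 0 0 r * (fst p * fst p) + 2 * Gi 0 1 r * (fst p * snd p) + Gi 1 1 r * (snd p * snd p)) + V r.
Proof.
  intros Hd. unfold ham. rewrite lc_quadratic. unfold vel. rewrite !sumk_2. cbn [cmp2 fst snd].
  unfold Ginv, detG in *. rewrite !Gmat_explicit in *. field. auto.
Qed.

Lemma Xr_explicit al r p : (al < 2)%nat -> det r <> 0 -> Xr k gs gm gg V A al r p = rvel al r p.
Proof.
  intros Hal Hd. unfold Xr, dpP, rvel.
  destruct al as [| [| al]]; [| | lia]; cbn [dd]; [unfold pd1 | unfold pd2];
    rewrite ?Ginv_sym; apply is_derive_unique;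
    [ apply (is_derive_ext (fun t => / 2 * (Gi 0 0 r * (t * t) + 2 * Gi 1 0 r * (t * snd p)
                                       + Gi 1 1 r * (snd p * snd p)) + V r))
    | apply (is_derive_ext (fun t => / 2 * (Gi 0 0 r * (fst p * fst p) + 2 * Gi 1 0 r * (fst p * t)
                                       + Gi 1 1 r * (t * t)) + V r)) ];
    try (intros; rewrite ham_explicit by auto; rewrite Ginv_sym; reflexivity);
    generalize (Gi 0 0 r) (Gi 1 0 r) (Gi 1 1 r) (V r); intros; auto_derive; auto; field.
Qed.

Lemma is_derive_update (a b : nat) (c : nat -> R) t0 :
  is_derive (fun t => if Nat.eqb b a then t else c b) t0 (if Nat.eqb b a then 1 else 0).
Proof. destruct (Nat.eqb b a); [exact (is_derive_id t0) | exact (is_derive_const (c b) t0)]. Qed.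

Lemma is_derive_lred_xi a r v (xi : nat -> R) : (a < k)%nat ->
  (forall a b, gg a b r = gg b a r) ->
  is_derive (fun t => lred k gs gm gg V r v (fun b => if Nat.eqb b a then t else xi b)) (xi a)
    (sumk 2 (fun al => gm a al r * cmp2 al v) + sumk k (fun b => gg a b r * xi b)).
Proof.
  intros Ha Hsym.
  set (upd := fun t b => if Nat.eqb b a then t else xi b).
  set (d := fun b : nat => if Nat.eqb b a then 1 else 0).
  assert (Hxi : forall b, upd (xi a) b = xi b)
    by (intros b; unfold upd; destruct (Nat.eqb_spec b a); subst; reflexivity).
  assert (D2 : is_derive (fun t => sumk k (fun a' => sumk 2 (fun al => gm a' al r * cmp2 al v * upd t a')))
                 (xi a) (sumk k (fun a' => sumk 2 (fun al => gm a' al r * cmp2 al v * d a')))).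
  { apply is_derive_sumk; intros a' _. apply is_derive_sumk; intros al _.
    apply (is_derive_scal (fun t => upd t a')), is_derive_update. }
  assert (D3 : is_derive (fun t => sumk k (fun a' => sumk k (fun b => gg a' b r * upd t a' * upd t b)))
                 (xi a) (sumk k (fun a' => sumk k (fun b => gg a' b r * (d a' * xi b + xi a' * d b))))).
  { apply is_derive_sumk; intros a' _. apply is_derive_sumk; intros b _.
    apply (is_derive_ext (fun t => gg a' b r * (upd t a' * upd t b))); [intros; ring_R |].
    replace (d a' * xi b + xi a' * d b) with (d a' * upd (xi a) b + upd (xi a) a' * d b)
      by (rewrite !Hxi; reflexivity).
    apply (is_derive_scal (fun t => upd t a' * upd t b)).
    apply (is_derive_mult (fun t => upd t a') (fun t => upd t b));
      [apply is_derive_update | apply is_derive_update | intros; apply Rmult_comm]. }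
  replace (sumk 2 (fun al => gm a al r * cmp2 al v) + sumk k (fun b => gg a b r * xi b))
    with (0 + sumk k (fun a' => sumk 2 (fun al => gm a' al r * cmp2 al v * d a'))
          + / 2 * sumk k (fun a' => sumk k (fun b => gg a' b r * (d a' * xi b + xi a' * d b))) - 0).
  - set (T1 := / 2 * sumk 2 (fun al => sumk 2 (fun be => gs al be r * cmp2 al v * cmp2 be v))).
    set (T2 := fun t => sumk k (fun a' => sumk 2 (fun al => gm a' al r * cmp2 al v * upd t a'))).
    set (T3 := fun t => sumk k (fun a' => sumk k (fun b => gg a' b r * upd t a' * upd t b))).
    apply (is_derive_ext (fun t => (T1 + T2 t + / 2 * T3 t) - V r)); [reflexivity |].
    apply (is_derive_minus (fun t => T1 + T2 t + / 2 * T3 t) (fun _ => V r));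
      [| exact (is_derive_const (V r) (xi a))].
    apply (is_derive_plus (fun t => T1 + T2 t) (fun t => / 2 * T3 t));
      [apply (is_derive_plus (fun _ => T1) T2); [exact (is_derive_const T1 (xi a)) | exact D2] |].
    apply (is_derive_scal T3 (xi a) (/ 2)), D3.
  - rewrite (sumk_ext k (fun a' => sumk 2 (fun al => gm a' al r * cmp2 al v * d a'))
              (fun a' => (if Nat.eqb a' a then 1 else 0) * sumk 2 (fun al => gm a' al r * cmp2 al v)))
      by (intros; rewrite !sumk_2; unfold d; ring).
    rewrite (sumk_ext k (fun a' => sumk k (fun b => gg a' b r * (d a' * xi b + xi a' * d b)))
              (fun a' => (if Nat.eqb a' a then 1 else 0) * sumk k (fun b => gg a' b r * xi b)
                         + sumk k (fun b => (if Nat.eqb b a then 1 else 0) * (gg a' b r * xi a'))))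
      by (intros; rewrite <- sumk_scal, <- sumk_plus; apply sumk_ext; intros; unfold d; ring).
    rewrite sumk_plus, !sumk_kronecker by auto.
    rewrite (sumk_ext k (fun a' => sumk k (fun b => (if Nat.eqb b a then 1 else 0) * (gg a' b r * xi a')))
               (fun a' => gg a a' r * xi a'))
      by (intros; rewrite sumk_kronecker, Hsym by auto; reflexivity).
    field.
Qed.

Lemma muc_explicit a r v : (a < k)%nat -> (forall a b, gg a b r = gg b a r) ->
  muc k gs gm gg V A a r v = M a 0 r * fst v + M a 1 r * snd v.
Proof.
  intros Ha Hsym. unfold muc.
  etransitivity; [apply is_derive_unique, (is_derive_lred_xi a r v (xic A r v) Ha Hsym) |].
  unfold Mm, xic. rewrite !sumk_2. cbn [cmp2].
  rewrite (sumk_ext k (fun b => gg a b r * - sumk 2 (fun al => A b al r * cmp2 al v))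
       (fun b => (- fst v) * (gg a b r * A b 0%nat r) + (- snd v) * (gg a b r * A b 1%nat r)))
    by (intros; rewrite sumk_2; cbn [cmp2]; ring).
  rewrite sumk_lin2. ring.
Qed.

Section StructureConstants.
Hypothesis HC : forall a b c, C a b c = - C a c b.

Lemma Bc_diag a al r : B a al al r = 0.
Proof. unfold Bc. rewrite (sumk_antisym k (fun b c => C a b c) (fun b => A b al r)); auto. ring. Qed.

Lemma Bc_antisym a r : B a 1 0 r = - B a 0 1 r.
Proof.
  unfold Bc. rewrite sumk_swap.
  rewrite (sumk_ext k _ (fun x => - sumk k (fun y => C a x y * A x 0%nat r * A y 1%nat r))).
  - rewrite sumk_opp. ring.
  - intros x _. rewrite <- sumk_opp. apply sumk_ext; intros y _. rewrite HC. ring.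
Qed.

Lemma Lam_diag al r p : Lam k C gs gm gg V A al al r p = 0.
Proof.
  unfold Lam. rewrite (sumk_ext k _ (fun _ => 0)); [apply sumk_zero |].
  intros; rewrite Bc_diag; ring.
Qed.

Lemma Lam_antisym r p : Lam k C gs gm gg V A 0 1 r p = - Lam k C gs gm gg V A 1 0 r p.
Proof. unfold Lam. rewrite <- sumk_opp. apply sumk_ext; intros. rewrite Bc_antisym. ring. Qed.

Lemma Xp0_Lam r p : det r <> 0 ->
  Xp k C gs gm gg V A 0 r p
  = - drP 0 (ham k gs gm gg V A) r p - Lam k C gs gm gg V A 1 0 r p * rvel 1 r p.
Proof.
  intros Hd. unfold Xp, Lam. f_equal.
  rewrite Rmult_comm, <- sumk_scal. apply sumk_ext; intros a _. rewrite sumk_2, Bc_diag.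
  change (dpP 1 (ham k gs gm gg V A) r p) with (Xr k gs gm gg V A 1 r p).
  rewrite Xr_explicit by auto. ring.
Qed.

Lemma Xp1_Lam r p : det r <> 0 ->
  Xp k C gs gm gg V A 1 r p
  = - drP 1 (ham k gs gm gg V A) r p + Lam k C gs gm gg V A 1 0 r p * rvel 0 r p.
Proof.
  intros Hd. unfold Xp, Lam. unfold Rminus. f_equal.
  rewrite Rmult_comm, <- sumk_scal, <- sumk_opp. apply sumk_ext; intros a _.
  rewrite sumk_2, Bc_diag, Bc_antisym.
  change (dpP 0 (ham k gs gm gg V A) r p) with (Xr k gs gm gg V A 0 r p).
  rewrite Xr_explicit by auto. ring.
Qed.

End StructureConstants.

(* [M_{b e} B^b_{12}]; contracting it with [G^{-1}] gives [K^gamma_{12}]. *)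
Definition MB (e : nat) (r : R * R) : R := sumk k (fun a => M a e r * B a 0 1 r).

Lemma Kc_MB ga r : Kc k C gs gm gg V A ga 0 1 r = MB 0 r * Gi 0 ga r + MB 1 r * Gi 1 ga r.
Proof.
  rewrite (Rmult_comm (MB 0 r)), (Rmult_comm (MB 1 r)).
  unfold Kc, MB. rewrite <- !sumk_scal, <- sumk_plus. apply sumk_ext; intros.
  rewrite sumk_2. ring.
Qed.

Lemma Lam10_MB r p : (forall a b, gg a b r = gg b a r) -> det r <> 0 ->
  Lam k C gs gm gg V A 1 0 r p = MB 0 r * rvel 0 r p + MB 1 r * rvel 1 r p.
Proof.
  intros Hsym Hd. rewrite (Rmult_comm (MB 0 r)), (Rmult_comm (MB 1 r)).
  unfold Lam, MB. rewrite <- !sumk_scal, <- sumk_plus. apply sumk_ext; intros a Ha.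
  rewrite muc_explicit by auto. unfold rdot. cbn [fst snd]. rewrite !Xr_explicit by auto. ring.
Qed.

Section Smoothness.
Variable U : R * R -> Prop.
Hypothesis HU : open U.
Hypothesis Hsm : forall i j, smooth_on U (gs i j) /\ smooth_on U (gm i j) /\
                             smooth_on U (gg i j) /\ smooth_on U (A i j).
Hypothesis Hd : forall r, U r -> det r <> 0.

Ltac smooth_closure_with hint := repeat first
  [ hint | apply (smooth_on_plus U HU) | apply (smooth_on_minus U HU) | apply (smooth_on_mult U HU)
  | apply (smooth_on_opp U HU) | apply (smooth_on_sumk U HU); intros | apply (smooth_on_const U HU)
  | apply (proj1 (Hsm _ _)) | apply (proj1 (proj2 (Hsm _ _)))
  | apply (proj1 (proj2 (proj2 (Hsm _ _)))) | apply (proj2 (proj2 (proj2 (Hsm _ _)))) ].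
Ltac smooth_closure := smooth_closure_with fail.

Lemma smooth_on_Gmat al be : smooth_on U (Gm al be).
Proof.
  apply (smooth_on_ext U HU (fun r => match al, be with
                                       | O, O => 2 * lc_c00 r
                                       | S _, S _ => 2 * lc_c11 r
                                       | _, _ => lc_c01 r end));
    [intros; symmetry; apply Gmat_explicit |].
  unfold lc_c00, lc_c01, lc_c11. destruct al, be; smooth_closure.
Qed.

Lemma smooth_on_Ginv al be : smooth_on U (Gi al be).
Proof.
  assert (Hdet : smooth_on U (fun r => / det r)).
  { apply (smooth_on_inv U HU); [unfold detG; apply (smooth_on_minus U HU);
      apply (smooth_on_mult U HU); apply smooth_on_Gmat | exact Hd]. }
  unfold Ginv, Rdiv. destruct al, be;
    apply (smooth_on_mult U HU); auto; try apply (smooth_on_opp U HU); apply smooth_on_Gmat.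
Qed.

Lemma smooth_on_Bc a al be : smooth_on U (B a al be).
Proof.
  unfold Bc. apply (smooth_on_plus U HU); [apply (smooth_on_minus U HU); apply (smooth_on_dd U) |];
    smooth_closure.
Qed.

Lemma smooth_on_Kc ga : smooth_on U (Kc k C gs gm gg V A ga 0 1).
Proof.
  apply (smooth_on_ext U HU (fun r => MB 0 r * Gi 0 ga r + MB 1 r * Gi 1 ga r));
    [intros; symmetry; apply Kc_MB |].
  apply (smooth_on_plus U HU); apply (smooth_on_mult U HU); try apply smooth_on_Ginv;
    unfold MB, Mm; smooth_closure_with ltac:(apply smooth_on_Bc).
Qed.

End Smoothness.

End ReducedSystem.

(** * Multipliers and invariant densities *)

Lemma pd1_mult_lincomb (N a b : R * R -> R) c0 c1 r :
  ex_derive (fun t => N (t, snd r)) (fst r) -> ex_derive (fun t => a (t, snd r)) (fst r) ->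
  ex_derive (fun t => b (t, snd r)) (fst r) ->
  pd1 (fun w => N w * (a w * c0 + b w * c1)) r
  = pd1 N r * (a r * c0 + b r * c1) + N r * (pd1 a r * c0 + pd1 b r * c1).
Proof.
  intros H1 H2 H3. destruct r as [r1 r2]. unfold pd1 in *. cbn [fst snd] in *.
  set (n := fun t => N (t, r2)) in *. set (a' := fun t => a (t, r2)) in *.
  set (b' := fun t => b (t, r2)) in *.
  change (Derive (fun t => n t * (a' t * c0 + b' t * c1)) r1
          = Derive n r1 * (a' r1 * c0 + b' r1 * c1) + n r1 * (Derive a' r1 * c0 + Derive b' r1 * c1)).
  apply is_derive_unique. auto_derive; [repeat split; auto | unfold n, a', b'; cbv beta; ring_R].
Qed.

Lemma pd2_mult_lincomb (N a b : R * R -> R) c0 c1 r :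
  ex_derive (fun t => N (fst r, t)) (snd r) -> ex_derive (fun t => a (fst r, t)) (snd r) ->
  ex_derive (fun t => b (fst r, t)) (snd r) ->
  pd2 (fun w => N w * (a w * c0 + b w * c1)) r
  = pd2 N r * (a r * c0 + b r * c1) + N r * (pd2 a r * c0 + pd2 b r * c1).
Proof.
  destruct r as [r1 r2].
  exact (pd1_mult_lincomb (fun w => N (swap2 w)) (fun w => a (swap2 w)) (fun w => b (swap2 w))
           c0 c1 (r2, r1)).
Qed.

Lemma pd1_quadratic_form (a b c W : R * R -> R) x0 x1 x2 r :
  ex_derive (fun t => a (t, snd r)) (fst r) -> ex_derive (fun t => b (t, snd r)) (fst r) ->
  ex_derive (fun t => c (t, snd r)) (fst r) -> ex_derive (fun t => W (t, snd r)) (fst r) ->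
  pd1 (fun w => / 2 * (a w * x0 + 2 * b w * x1 + c w * x2) + W w) r
  = / 2 * (pd1 a r * x0 + 2 * pd1 b r * x1 + pd1 c r * x2) + pd1 W r.
Proof.
  intros H1 H2 H3 H4. destruct r as [r1 r2]. unfold pd1 in *. cbn [fst snd] in *.
  set (a' := fun t => a (t, r2)) in *. set (b' := fun t => b (t, r2)) in *.
  set (c' := fun t => c (t, r2)) in *. set (w := fun t => W (t, r2)) in *.
  change (Derive (fun t => / 2 * (a' t * x0 + 2 * b' t * x1 + c' t * x2) + w t) r1
          = / 2 * (Derive a' r1 * x0 + 2 * Derive b' r1 * x1 + Derive c' r1 * x2) + Derive w r1).
  apply is_derive_unique. auto_derive; [repeat split; auto | unfold a', b', c', w; cbv beta; ring_R].
Qed.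

Lemma pd2_quadratic_form (a b c W : R * R -> R) x0 x1 x2 r :
  ex_derive (fun t => a (fst r, t)) (snd r) -> ex_derive (fun t => b (fst r, t)) (snd r) ->
  ex_derive (fun t => c (fst r, t)) (snd r) -> ex_derive (fun t => W (fst r, t)) (snd r) ->
  pd2 (fun w => / 2 * (a w * x0 + 2 * b w * x1 + c w * x2) + W w) r
  = / 2 * (pd2 a r * x0 + 2 * pd2 b r * x1 + pd2 c r * x2) + pd2 W r.
Proof.
  destruct r as [r1 r2].
  exact (pd1_quadratic_form (fun w => a (swap2 w)) (fun w => b (swap2 w)) (fun w => c (swap2 w))
           (fun w => W (swap2 w)) x0 x1 x2 (r2, r1)).
Qed.

Ltac phase_C1_coordinate :=
  intros al Hal; destruct al as [| [| al]]; [| | lia]; repeat split;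
  unfold exd, uncurry2, drP, dpP, dd, pd1, pd2; simpl;
  first [ apply ex_derive_const | apply ex_derive_id
        | apply (continuous_ext (fun _ => 0)); [intros; symmetry; apply Derive_const | apply continuous_const]
        | apply (continuous_ext (fun _ => 1)); [intros; symmetry; apply Derive_id | apply continuous_const] ].

Lemma phase_C1_fst U : phase_C1 U (fun _ P => fst P).
Proof.
  intros r p Hr. split; [| phase_C1_coordinate].
  apply (continuous_comp (fun z : (R * R) * (R * R) => snd z) fst);
    [apply continuous_snd_pt | apply continuous_fst_pt].
Qed.

Lemma phase_C1_snd U : phase_C1 U (fun _ P => snd P).
Proof.
  intros r p Hr. split; [| phase_C1_coordinate].
  apply (continuous_comp (fun z : (R * R) * (R * R) => snd z) snd);
    [apply continuous_snd_pt | apply continuous_snd_pt].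
Qed.

Section Hamiltonization.
Variable k : nat.
Variable C : nat -> nat -> nat -> R.
Variables gs gm gg : nat -> nat -> R * R -> R.
Variable V : R * R -> R.
Variable A : nat -> nat -> R * R -> R.
Variable U : R * R -> Prop.
Hypothesis HU : open U.
Hypothesis HC : forall a b c, C a b c = - C a c b.
Hypothesis Hsym : forall r, U r -> forall a b, gg a b r = gg b a r.
Hypothesis Hd : forall r, U r -> detG k gs gm gg V A r <> 0.

Local Notation K1 := (Kc k C gs gm gg V A 0 0 1).
Local Notation K2 := (Kc k C gs gm gg V A 1 0 1).
Local Notation Lm := (Lam k C gs gm gg V A).

(* The paper's [f = e^{int K^1_12 dr^2}], written as the first-order system it solves. *)
Definition multiplier_pde (f : R * R -> R) : Prop :=
  C1_on U f /\ (forall r, U r -> f r <> 0) /\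
  forall r, U r -> pd2 f r = K1 r * f r /\ pd1 f r = - K2 r * f r.

Lemma Lam01_K r p : U r -> Lm 0 1 r p = - (fst p * K1 r + snd p * K2 r).
Proof.
  intros Hr. rewrite (Lam_antisym k C gs gm gg V A HC), (Lam10_MB k C gs gm gg V A) by auto.
  rewrite !Kc_MB. unfold rvel. rewrite Ginv_sym. ring.
Qed.

Lemma AP_br_rescale g h f r p : phase_C1 U g -> phase_C1 U h -> C1_on U f -> U r ->
  AP_br k C gs gm gg V A (fun r' p' => g r' (f r' * fst p', f r' * snd p'))
    (fun r' p' => h r' (f r' * fst p', f r' * snd p')) r p
    - f r * can_br g h r (f r * fst p, f r * snd p)
  = f r * (dpP 0 g r (rescale f r p) * dpP 1 h r (rescale f r p)
           - dpP 1 g r (rescale f r p) * dpP 0 h r (rescale f r p))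
        * (pd2 f r * fst p - pd1 f r * snd p - f r * (fst p * K1 r + snd p * K2 r)).
Proof.
  intros Hg Hh Hf Hr.
  change (f r * fst p, f r * snd p) with (rescale f r p).
  change (fun r' p' => g r' (f r' * fst p', f r' * snd p')) with (fun r p => g r (rescale f r p)).
  change (fun r' p' => h r' (f r' * fst p', f r' * snd p')) with (fun r p => h r (rescale f r p)).
  unfold AP_br, can_br. rewrite !sumk_2.
  rewrite !(dpP0_rescale U g Hg f), !(dpP1_rescale U g Hg f), !(dpP0_rescale U h Hh f),
    !(dpP1_rescale U h Hh f), (drP0_rescale U HU g Hg f Hf), (drP1_rescale U g f HU Hg Hf),
    (drP0_rescale U HU h Hh f Hf), (drP1_rescale U h f HU Hh Hf) by auto.
  replace (Lm 1 0 r p) with (- Lm 0 1 r p) by (rewrite (Lam_antisym k C gs gm gg V A HC); ring).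
  rewrite !(Lam_diag k C gs gm gg V A HC), Lam01_K by auto.
  ring.
Qed.

Lemma multiplier_pde_of_multiplier f :
  is_multiplier k C gs gm gg V A U f -> multiplier_pde f.
Proof.
  intros [Hf [Hnz Hm]]. split; [auto | split; [auto |]].
  intros r Hr. assert (Hfr := Hnz r Hr).
  assert (E : forall p, pd2 f r * fst p - pd1 f r * snd p - f r * (fst p * K1 r + snd p * K2 r) = 0).
  { intros p. apply (Rmult_eq_reg_l (f r)); auto.
    assert (I := AP_br_rescale _ _ f r p (phase_C1_fst U) (phase_C1_snd U) Hf Hr). cbv beta in I.
    rewrite (Hm _ _ (phase_C1_fst U) (phase_C1_snd U) r p Hr), Rminus_diag in I.
    unfold dpP, dd, pd1, pd2 in *. cbn [fst snd] in I. rewrite !Derive_id, !Derive_const in I.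
    rewrite Rmult_0_r.
    match type of I with 0 = ?X => transitivity X; [ring | symmetry; exact I] end. }
  specialize (E (1, 0)) as E1. specialize (E (0, 1)) as E2. cbn [fst snd] in E1, E2.
  split; lra.
Qed.

Lemma multiplier_of_multiplier_pde f :
  multiplier_pde f -> is_multiplier k C gs gm gg V A U f.
Proof.
  intros [Hf [Hnz HP]]. split; [auto | split; [auto |]].
  intros g h Hg Hh r p Hr.
  assert (I := AP_br_rescale g h f r p Hg Hh Hf Hr).
  destruct (HP r Hr) as [-> ->] in I.
  apply Rminus_diag_uniq. rewrite I. ring.
Qed.

Hypothesis Hsm : forall i j, smooth_on U (gs i j) /\ smooth_on U (gm i j) /\
                             smooth_on U (gg i j) /\ smooth_on U (A i j).
Hypothesis HV : smooth_on U V.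

Local Notation Gi := (Ginv k gs gm gg V A).
Local Notation v := (rvel k gs gm gg V A).
Local Notation H := (ham k gs gm gg V A).
Local Notation MB := (MB k C gm gg A).

Lemma C1_on_Ginv al be : C1_on U (Gi al be).
Proof. exact (smooth_on_Ginv k gs gm gg V A U HU Hsm Hd al be 1%nat). Qed.

Ltac C1_on_data F :=
  lazymatch F with
  | V => exact (HV 1%nat)
  | Ginv _ _ _ _ _ _ ?a ?b => exact (C1_on_Ginv a b)
  | _ => assumption
  end.

Ltac ex_derive_C1 :=
  let HF := fresh in
  lazymatch goal with
  | |- ex_derive (fun t => ?F (t, snd ?r)) (fst ?r) =>
      assert (HF : C1_on U F) by C1_on_data F;
      exact (C1_on_ex_derive1 U F HF r ltac:(assumption))
  | |- ex_derive (fun t => ?F (fst ?r, t)) (snd ?r) =>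
      assert (HF : C1_on U F) by C1_on_data F;
      exact (C1_on_ex_derive2 U F HF r ltac:(assumption))
  end.

Lemma drP0_ham r p : U r ->
  drP 0 H r p = / 2 * (pd1 (Gi 0 0) r * (fst p * fst p) + 2 * pd1 (Gi 0 1) r * (fst p * snd p)
                       + pd1 (Gi 1 1) r * (snd p * snd p)) + pd1 V r.
Proof.
  intros Hr. unfold drP, dd.
  rewrite (pd1_ext_on U HU _ (fun r' => / 2 * (Gi 0 0 r' * (fst p * fst p) + 2 * Gi 0 1 r' * (fst p * snd p)
         + Gi 1 1 r' * (snd p * snd p)) + V r')) by (auto; intros; apply ham_explicit; auto).
  apply (pd1_quadratic_form (Gi 0 0) (Gi 0 1) (Gi 1 1) V); ex_derive_C1.
Qed.

Lemma drP1_ham r p : U r ->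
  drP 1 H r p = / 2 * (pd2 (Gi 0 0) r * (fst p * fst p) + 2 * pd2 (Gi 0 1) r * (fst p * snd p)
                       + pd2 (Gi 1 1) r * (snd p * snd p)) + pd2 V r.
Proof.
  intros Hr. unfold drP, dd.
  rewrite (pd2_ext_on U HU _ (fun r' => / 2 * (Gi 0 0 r' * (fst p * fst p) + 2 * Gi 0 1 r' * (fst p * snd p)
         + Gi 1 1 r' * (snd p * snd p)) + V r')) by (auto; intros; apply ham_explicit; auto).
  apply (pd2_quadratic_form (Gi 0 0) (Gi 0 1) (Gi 1 1) V); ex_derive_C1.
Qed.

Section Density.
Variable N : R * R -> R.
Hypothesis HN : C1_on U N.

Lemma drP0_density_Xr r p : U r ->
  drP 0 (fun r' p' => N r' * Xr k gs gm gg V A 0 r' p') r p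
  = pd1 N r * v 0 r p + N r * (pd1 (Gi 0 0) r * fst p + pd1 (Gi 0 1) r * snd p).
Proof.
  intros Hr. unfold drP, dd.
  rewrite (pd1_ext_on U HU _ (fun r' => N r' * (Gi 0 0 r' * fst p + Gi 0 1 r' * snd p)))
    by (auto; intros; rewrite Xr_explicit; auto).
  apply (pd1_mult_lincomb N (Gi 0 0) (Gi 0 1)); ex_derive_C1.
Qed.

Lemma drP1_density_Xr r p : U r ->
  drP 1 (fun r' p' => N r' * Xr k gs gm gg V A 1 r' p') r p
  = pd2 N r * v 1 r p + N r * (pd2 (Gi 1 0) r * fst p + pd2 (Gi 1 1) r * snd p).
Proof.
  intros Hr. unfold drP, dd.
  rewrite (pd2_ext_on U HU _ (fun r' => N r' * (Gi 1 0 r' * fst p + Gi 1 1 r' * snd p)))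
    by (auto; intros; rewrite Xr_explicit; auto).
  apply (pd2_mult_lincomb N (Gi 1 0) (Gi 1 1)); ex_derive_C1.
Qed.

Lemma dpP0_density_Xp r p : U r ->
  dpP 0 (fun r' p' => N r' * Xp k C gs gm gg V A 0 r' p') r p
  = N r * (- (pd1 (Gi 0 0) r * fst p + pd1 (Gi 0 1) r * snd p)
           - ((MB 0 r * Gi 0 0 r + MB 1 r * Gi 1 0 r) * v 1 r p
              + (MB 0 r * v 0 r p + MB 1 r * v 1 r p) * Gi 1 0 r)).
Proof.
  intros Hr. unfold dpP, dd, rvel. unfold pd1 at 1. apply is_derive_unique.
  apply (is_derive_ext (fun t => N r * (- (/ 2 * (pd1 (Gi 0 0) r * (t * t) + 2 * pd1 (Gi 0 1) r * (t * snd p)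
                                     + pd1 (Gi 1 1) r * (snd p * snd p)) + pd1 V r)
      - (MB 0 r * (Gi 0 0 r * t + Gi 0 1 r * snd p) + MB 1 r * (Gi 1 0 r * t + Gi 1 1 r * snd p))
        * (Gi 1 0 r * t + Gi 1 1 r * snd p)))).
  { intros t. rewrite (Xp0_Lam k C gs gm gg V A HC), drP0_ham, (Lam10_MB k C gs gm gg V A) by auto.
    reflexivity. }
  generalize (pd1 (Gi 0 0) r) (pd1 (Gi 0 1) r) (pd1 (Gi 1 1) r) (pd1 V r) (Gi 0 0 r) (Gi 0 1 r)
    (Gi 1 0 r) (Gi 1 1 r) (MB 0 r) (MB 1 r) (N r); intros.
  auto_derive; auto. field.
Qed.

Lemma dpP1_density_Xp r p : U r ->
  dpP 1 (fun r' p' => N r' * Xp k C gs gm gg V A 1 r' p') r p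
  = N r * (- (pd2 (Gi 0 1) r * fst p + pd2 (Gi 1 1) r * snd p)
           + ((MB 0 r * Gi 0 1 r + MB 1 r * Gi 1 1 r) * v 0 r p
              + (MB 0 r * v 0 r p + MB 1 r * v 1 r p) * Gi 0 1 r)).
Proof.
  intros Hr. unfold dpP, dd, rvel. unfold pd2 at 1. apply is_derive_unique.
  apply (is_derive_ext (fun t => N r * (- (/ 2 * (pd2 (Gi 0 0) r * (fst p * fst p)
                                     + 2 * pd2 (Gi 0 1) r * (fst p * t) + pd2 (Gi 1 1) r * (t * t)) + pd2 V r)
      + (MB 0 r * (Gi 0 0 r * fst p + Gi 0 1 r * t) + MB 1 r * (Gi 1 0 r * fst p + Gi 1 1 r * t))
        * (Gi 0 0 r * fst p + Gi 0 1 r * t)))).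
  { intros t. rewrite (Xp1_Lam k C gs gm gg V A HC), drP1_ham, (Lam10_MB k C gs gm gg V A) by auto.
    reflexivity. }
  generalize (pd2 (Gi 0 0) r) (pd2 (Gi 0 1) r) (pd2 (Gi 1 1) r) (pd2 V r) (Gi 0 0 r) (Gi 0 1 r)
    (Gi 1 0 r) (Gi 1 1 r) (MB 0 r) (MB 1 r) (N r); intros.
  auto_derive; auto. field.
Qed.

Lemma divergence_density r p : U r ->
  sumk 2 (fun al => drP al (fun r' p' => N r' * Xr k gs gm gg V A al r' p') r p
                  + dpP al (fun r' p' => N r' * Xp k C gs gm gg V A al r' p') r p)
  = (pd1 N r + N r * K2 r) * v 0 r p + (pd2 N r - N r * K1 r) * v 1 r p.
Proof.
  intros Hr. rewrite sumk_2, drP0_density_Xr, drP1_density_Xr, dpP0_density_Xp, dpP1_density_Xp by auto.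
  assert (Hsym2 : pd2 (Gi 1 0) r = pd2 (Gi 0 1) r)
    by (apply Derive_ext; intros; symmetry; apply Ginv_sym).
  rewrite Hsym2, !Kc_MB. unfold rvel. rewrite !(Ginv_sym k gs gm gg V A r). ring.
Qed.

End Density.

Lemma multiplier_pde_of_invariant_density N :
  invariant_density k C gs gm gg V A U N -> multiplier_pde N.
Proof.
  intros [HN [Hnz Hdiv]]. split; [auto | split; [auto |]].
  intros r Hr.
  assert (E : forall p, (pd1 N r + N r * K2 r) * v 0 r p + (pd2 N r - N r * K1 r) * v 1 r p = 0)
    by (intros p; rewrite <- divergence_density; auto).
  destruct (rvel_Gmat k gs gm gg V A r 0 (Hd r Hr)) as [V00 V10].
  destruct (rvel_Gmat k gs gm gg V A r 1 (Hd r Hr)) as [V01 V11].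
  assert (E0 := E (Gmat k gs gm gg V A 0 0 r, Gmat k gs gm gg V A 1 0 r)).
  assert (E1 := E (Gmat k gs gm gg V A 0 1 r, Gmat k gs gm gg V A 1 1 r)).
  rewrite V00, V10 in E0. rewrite V01, V11 in E1. cbn [Nat.eqb] in E0, E1.
  split; lra.
Qed.

Lemma invariant_density_of_multiplier_pde N :
  multiplier_pde N -> invariant_density k C gs gm gg V A U N.
Proof.
  intros [HN [Hnz HP]]. split; [auto | split; [auto |]].
  intros r p Hr. rewrite divergence_density by auto.
  destruct (HP r Hr) as [-> ->]. ring.
Qed.

End Hamiltonization.

Lemma exp_potential_solves (U : R * R -> Prop) (K1 K2 : R * R -> R) c :
  open U -> convex_set U -> U c -> C1_on U K1 -> C1_on U K2 ->
  (forall r, U r -> pd1 K1 r = - pd2 K2 r) ->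
  exists f, C1_on U f /\ (forall r, U r -> f r <> 0) /\
            forall r, U r -> pd2 f r = K1 r * f r /\ pd1 f r = - K2 r * f r.
Proof.
  intros HU Hcv Hc HK1 HK2 Hcl.
  set (a := fun r => - K2 r).
  assert (Ha : C1_on U a) by (apply Ck_opp; auto).
  assert (Hcl' : forall r, U r -> pd2 a r = pd1 K1 r)
    by (intros r Hr; unfold a, pd2; rewrite Derive_opp; symmetry; apply Hcl, Hr).
  set (phi := radial_potential c a K1).
  assert (Hphi : C1_on U phi) by exact (C1_on_radial_potential U HU Hcv c Hc a K1 Ha HK1 Hcl').
  destruct (C1_on_exp U phi HU Hphi) as [Hf Hpd].
  exists (fun r => exp (phi r)). split; [exact Hf | split; [intros; apply Rgt_not_eq, exp_pos |]].
  intros r Hr. destruct (Hpd r Hr) as [-> ->]. unfold phi.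
  rewrite (pd1_radial_potential U HU Hcv c Hc a K1 Ha HK1 Hcl' r Hr),
          (pd2_radial_potential U HU Hcv c Hc a K1 Ha HK1 Hcl' r Hr).
  split; reflexivity.
Qed.
Theorem corollary4
  (U : R * R -> Prop) (k : nat) (C : nat -> nat -> nat -> R)
  (gs gm gg : nat -> nat -> R * R -> R) (V : R * R -> R)
  (A : nat -> nat -> R * R -> R) :
  (exists r0, U r0) -> open U -> convex_set U ->
  (forall a b c, C a b c = - C a c b) ->
  (forall a b c e, (a < k)%nat -> (b < k)%nat -> (c < k)%nat -> (e < k)%nat ->
     sumk k (fun d => C d b c * C a d e + C d c e * C a d b + C d e b * C a d c) = 0) ->
  (exists a b c, (a < k)%nat /\ (b < k)%nat /\ (c < k)%nat /\ C a b c <> 0) ->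
  (forall i j, smooth_on U (gs i j) /\ smooth_on U (gm i j) /\
               smooth_on U (gg i j) /\ smooth_on U (A i j)) ->
  smooth_on U V ->
  (forall al be r, U r -> gs al be r = gs be al r) ->
  (forall a b r, U r -> gg a b r = gg b a r) ->
  (forall r (v : R * R) (w : nat -> R), U r ->
     (v <> (0, 0) \/ exists a, (a < k)%nat /\ w a <> 0) ->
     0 < sumk 2 (fun al => sumk 2 (fun be => gs al be r * cmp2 al v * cmp2 be v))
         + 2 * sumk k (fun a => sumk 2 (fun al => gm a al r * cmp2 al v * w a))
         + sumk k (fun a => sumk k (fun b => gg a b r * w a * w b))) ->
  (forall r, U r -> detG k gs gm gg V A r <> 0) ->
  (chaplygin_hamiltonizable k C gs gm gg V A U <->
     (forall r, U r ->
        pd1 (Kc k C gs gm gg V A 0 0 1) r = - pd2 (Kc k C gs gm gg V A 1 0 1) r))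
  /\
  (chaplygin_hamiltonizable k C gs gm gg V A U <->
     exists N, invariant_density k C gs gm gg V A U N)
  /\
  (forall f, is_multiplier k C gs gm gg V A U f ->
     (forall r, U r ->
        pd2 f r = Kc k C gs gm gg V A 0 0 1 r * f r /\
        pd1 f r = - Kc k C gs gm gg V A 1 0 1 r * f r)
     /\ invariant_density k C gs gm gg V A U f).
Proof.
  intros [r0 Hr0] HU Hcv HC _ _ Hsm HV _ Hgg _ Hd.
  assert (Hsym : forall r, U r -> forall a b, gg a b r = gg b a r) by auto.
  assert (HK : forall ga, C1_on U (Kc k C gs gm gg V A ga 0 1))
    by (intros ga; exact (smooth_on_Kc k C gs gm gg V A U HU Hsm Hd ga 1%nat)).
  assert (Hpde := multiplier_pde_of_multiplier k C gs gm gg V A U HU HC Hsym Hd).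
  assert (Hmult := multiplier_of_multiplier_pde k C gs gm gg V A U HU HC Hsym Hd).
  assert (Hinv := invariant_density_of_multiplier_pde k C gs gm gg V A U HU HC Hsym Hd Hsm HV).
  split; [split | split; [split |]].
  - intros [f Hf] r Hr. destruct (Hpde f Hf) as [Hf1 [Hnz HP]].
    apply (closed_of_log_gradient U HU _ _ f (HK 0%nat) (HK 1%nat) Hf1 Hnz); auto; apply HP.
  - intros Hcl. destruct (exp_potential_solves U _ _ r0 HU Hcv Hr0 (HK 0%nat) (HK 1%nat) Hcl) as [f Hf].
    exists f. apply Hmult, Hf.
  - intros [f Hf]. exists f. apply Hinv, Hpde, Hf.
  - intros [N HN]. exists N. apply Hmult.
    exact (multiplier_pde_of_invariant_density k C gs gm gg V A U HU HC Hsym Hd Hsm HV N HN).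
  - intros f Hf. split; [apply Hpde, Hf | apply Hinv, Hpde, Hf].
Qed.
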